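(* Let $r\ge3$ and $m\ge4$. Among all $r$-uniform supertrees with $m$ edges, the first two smallest spectral radii are attained by $P_m^r$ and $D_{m,r}$: namely $\rho(P_m^r)<\rho(D_{m,r})$, and every $r$-uniform supertree $\mathcal{T}$ with $m$ edges not isomorphic to $P_m^r$ satisfies $\rho(\mathcal{T})\ge\rho(D_{m,r})$.
   Context: All hypergraphs are $r$-uniform (every edge has exactly $r$ vertices) and linear (two edges share at most one vertex). A supertree is a connected hypergraph containing no cycle (a cycle being a closed alternating sequence of vertices and edges, all distinct, consecutive vertices lying in the edge between them). The degree of a vertex is the number of edges containing it; a core vertex is a vertex of degree one. The adjacency tensor of a hypergraph on $n$ vertices is the order-$r$, dimension-$n$ tensor with entry $1/(r-1)!$ at $(i_1,\dots,i_r)$ if $\{i_1,\dots,i_r\}$ is an edge and $0$ otherwise; $\lambda$ is an eigenvalue if $\mathcal{A}x=\lambda x^{[r-1]}$ for some nonzero $x\in\mathbb{C}^n$, where $(\mathcal{A}x)_i=\sum_{i_2,\dots,i_r}a_{ii_2\cdots i_r}x_{i_2}\cdots x_{i_r}$, $(x^{[r-1]})_i=x_i^{r-1}$; $\rho(\cdot)$ denotes the maximum modulus of the eigenvalues (spectral radius). The loose path $P_k^r=(v_1,e_1,v_2,\dots,e_k,v_{k+1})$ is the $r$-uniform hypergraph whose edges are $e_i=\{v_i,v_{i+1}\}$ together with $r-2$ further vertices of degree one (distinct for distinct edges). $D_{m,r}$ is the supertree obtained from $P_{m-1}^r=(v_1,e_1,\dots,e_{m-1},v_m)$ by attaching a pendent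 edge (a new edge meeting the hypergraph in exactly one vertex, its other $r-1$ vertices being new) at a core vertex of $e_2$, i.e. a vertex of $e_2$ other than $v_2,v_3$. *)

(* Defs.v *)
From HB Require Import structures.
From mathcomp Require Import all_boot all_order all_algebra.
From mathcomp Require Import boolp classical_sets reals.
From mathcomp Require Export complex.

Set Implicit Arguments.
Unset Strict Implicit.
Unset Printing Implicit Defensive.

Import Order.TTheory GRing.Theory Num.Theory.
Local Open Scope ring_scope.
Local Open Scope complex_scope.

(* A hypergraph is given by its set of edges
   E : {set {set V}}; its vertices are all the elements of V. *)

Section Tensors.

Variables (R : realType) (V : finType).

(* Tensors of order k over R[i], with indices in V (dimension #|V|). *)
Definition tensor (k : nat) := k.-tuple V -> R[i].

Definition tensor_apply (k : nat) (A : tensor k.+1) (x : V -> R[i]) (v : V)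
    : R[i] :=
  \sum_(t : k.-tuple V) A [tuple of v :: t] * \prod_(j < k) x (tnth t j).

Definition tensor_eigenvalue (k : nat) (A : tensor k.+1) (l : R[i]) : Prop :=
  exists x : V -> R[i],
    (exists v, x v != 0) /\ forall v, tensor_apply A x v = l * x v ^+ k.

(* The supremum is a maximum: a tensor has finitely many eigenvalues. The norm
   of a complex number lives in R[i], whence the real part. *)
Definition tensor_spectral_radius (k : nat) (A : tensor k.+1) : R :=
  sup [set complex.Re `|l| | l in tensor_eigenvalue A]%classic.

(* If E is k.+1-uniform and the underlying set of t is an edge, then the
   entries of t are pairwise distinct. *)
Definition adjacency_tensor (k : nat) (E : {set {set V}}) : tensor k.+1 :=
  fun t => if [set v in t] \in E then (k`!%:R)^-1 else 0.

(* The order r.-1.+1 is r for positive r. *)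
Definition spectral_radius (r : nat) (E : {set {set V}}) : R :=
  tensor_spectral_radius (@adjacency_tensor r.-1 E).

End Tensors.

Section Hypergraphs.

Variable V : finType.
Implicit Types E : {set {set V}}.

Definition uniform (r : nat) E : Prop := forall e, e \in E -> #|e| = r.

Definition linear_hypergraph E : Prop :=
  forall e f, e \in E -> f \in E -> e != f -> (#|e :&: f| <= 1)%N.

Definition adjacent E : rel V :=
  fun u v => [exists e in E, (u \in e) && (v \in e)].

Definition connected_hypergraph E : Prop :=
  forall u v : V, connect (adjacent E) u v.

(* The closed sequence v 0, e 0, v 1, e 1, ..., v (n - 1), e (n - 1), v 0;
   ordS is the cyclic successor on 'I_n. *)
Definition is_cycle E (n : nat) (v : 'I_n -> V) (e : 'I_n -> {set V}) : Prop :=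
  [/\ (2 <= n)%N, injective v, injective e, forall i, e i \in E
    & forall i, v i \in e i /\ v (ordS i) \in e i].

Definition acyclic E : Prop :=
  forall (n : nat) (v : 'I_n -> V) (e : 'I_n -> {set V}), ~ is_cycle E v e.

Definition supertree (r : nat) E : Prop :=
  [/\ uniform r E, linear_hypergraph E, connected_hypergraph E & acyclic E].

Definition attach_pendent (r : nat) E (u : V) : {set {set (V + 'I_r.-1)%type}} :=
  (inl u |: [set inr j | j : 'I_r.-1])
    |: [set [set inl w | w in (e : {set V})] | e in E].

End Hypergraphs.

Definition isomorphic (V W : finType) (E : {set {set V}}) (F : {set {set W}})
    : Prop :=
  exists2 f : V -> W, bijective f & F = [set f @: (e : {set V}) | e in E].

(* The vertices of the loose path are 0, ..., m (r - 1). Its edge e_(i+1) is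
   the interval [i (r - 1), (i + 1) (r - 1)], so that v_(i+1) = i (r - 1). *)
Definition loose_edge (r m : nat) (i : 'I_m) : {set 'I_(m * r.-1).+1} :=
  [set j : 'I_(m * r.-1).+1 | (i * r.-1 <= j <= i.+1 * r.-1)%N].

Definition loose_path (r m : nat) : {set {set 'I_(m * r.-1).+1}} :=
  [set loose_edge r i | i : 'I_m].

(* For 3 <= r and 4 <= m, the vertex r is a core vertex of e_2, which is the
   interval [r - 1, 2 (r - 1)] with v_2 = r - 1 and v_3 = 2 (r - 1). All the
   core vertices of e_2 give isomorphic hypergraphs. *)
Definition D_supertree (r m : nat)
    : {set {set ('I_(m.-1 * r.-1).+1 + 'I_r.-1)%type}} :=
  attach_pendent r (loose_path r m.-1) (inord r).

(* Main.v *)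
(* The Perron vector [x] of a supertree [T] with spectral radius [rho] yields the
   labels [B v e = x^e / (rho * x v ^ r)] on incident pairs; they add up to [1] at
   each vertex and have product [al = rho ^- r] on each edge. Conversely, labels
   with sums at most [1] and products at least [l ^- r] force [rho <= l], by the
   AM-GM inequality applied to the terms of the Rayleigh quotient.

   Among the branches with [n] edges rooted at a vertex, the loose path leaves
   the largest remainder [gap n] at its root. If [T] has a vertex of degree three
   or an edge with three vertices that are not core, then its labels and the
   exchange inequality [gap a.+1 * gap b <= gap a * gap b.+1] for [a <= b] give
   [al <= gap 1 ^ 2 * gap (m - 3)]. This is the condition for explicit labels on
   [D_{m,r}], so [rho D <= rho T]; with [T = D] it also gives [al < gap (m - 1)],
   hence labels on the path with a deficient vertex, so [rho P < rho D]. A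
   supertree without such a vertex or edge is a loose path. *)

Require Import Defs.
From mathcomp Require Import boolp classical_sets reals topology normedtype.
From mathcomp Require Import derive.
From mathcomp Require Import all_boot all_order all_algebra.
From mathcomp Require Import ring lra zify.

Set Implicit Arguments.
Unset Strict Implicit.
Unset Printing Implicit Defensive.

Import Order.TTheory GRing.Theory Num.Theory.
Import numFieldNormedType.Exports.
Local Open Scope ring_scope.

(** Two ways of combining branches govern the bounds. Branches at one vertex add up what they take
    from it, and [gap_add] says that a single path with as many edges takes no more. Branches at
    several vertices of one edge multiply their remainders, and [gap_merge] says that a single path
    leaves no less, up to the truncation at [al]. Both rest on the exchange inequality, which is
    available only while the product of the gaps reaches [al]; this is why so many statements carry
    a maximum with [al]. The value [gap 1 ^+ 2 * gap (m - 3)] belongs to an edge with branches of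
    sizes 1, 1 and m - 3, as at the edge e_2 of D.

    The spectral radius is a supremum over complex eigenvalues, so the Perron vector is constructed:
    it maximizes the sum of the edge products relative to the sum of the r-th powers. Its eigenvalue
    equations, its positivity and its dominance over all complex eigenvalues follow from this
    maximality. *)

(** * The gap sequence and its exchange inequalities *)

Section Gaps.

Variables (R : realFieldType) (al : R).

(* [gap n] is what remains at the root [v] of a loose path with [n] edges hanging
   at its end [v], when each edge has label product [al] and the labels at each
   other vertex add up to [1]. Once [gap n <= al] no such labels exist, and the
   truncation by [Num.max] makes the sequence vanish. *)
Fixpoint gap (n : nat) : R :=
  if n is k.+1 then 1 - al / Num.max al (gap k) else 1.

Lemma gapS n : gap n.+1 = 1 - al / Num.max al (gap n).
Proof. by []. Qed.

Hypothesis al_gt0 : 0 < al.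

Let max_gt0 x : 0 < Num.max al x.
Proof. by rewrite lt_max al_gt0. Qed.

Lemma gap_ge0 n : 0 <= gap n.
Proof.
case: n => [|n] /=; first exact: ler01.
by rewrite subr_ge0 ler_pdivrMr ?max_gt0// mul1r le_max lexx.
Qed.

Lemma gapS_lt1 n : gap n.+1 < 1.
Proof. by rewrite /= gtrBl divr_gt0 ?max_gt0. Qed.

Lemma gap_le1 n : gap n <= 1.
Proof. by case: n => [|n]; [exact: lexx | exact/ltW/gapS_lt1]. Qed.

Lemma gap_lt1 n : (0 < n)%N -> gap n < 1.
Proof. by case: n => // n _; exact: gapS_lt1. Qed.

Lemma gap_nonincreasing a b : (a <= b)%N -> gap b <= gap a.
Proof.
have gapS_le n : gap n.+1 <= gap n.
  elim: n => [|n IHn]; first exact/ltW/gapS_lt1.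
  rewrite [gap n.+2]/= [leRHS]/= lerD2l lerN2 ler_pM2l// lef_pV2 ?posrE ?max_gt0//.
  by rewrite ge_max !le_max lexx /= IHn orbT.
elim: b => [|b IHb]; first by rewrite leqn0 => /eqP ->.
rewrite leq_eqVlt => /orP[/eqP -> //|]; rewrite ltnS => /IHb.
exact/le_trans/gapS_le.
Qed.

(** Since [gap a < 1], the product drops strictly below [gap b]. This discharges the truncation:
    [Num.max al (gap b)] is then [gap b]. *)
Lemma gap_gt a b : al <= gap a * gap b -> (0 < a)%N -> al < gap b.
Proof.
move=> hab a_gt0; have b_gt0 : 0 < gap b.
  rewrite lt_neqAle gap_ge0 andbT eq_sym; apply/negP => /eqP b0.
  by move: hab; rewrite b0 mulr0 leNgt al_gt0.
by apply: le_lt_trans hab _; rewrite gtr_pMl ?gap_lt1.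
Qed.

(** With [x = gap a] and [y = gap b], the difference of the two sides times [x * y] is
    [(x - y) * x * (gap a.+1 * gap b - al)]. Monotonicity gives the sign of the first factor, the
    hypothesis on [al] that of the last. *)
Lemma gap_shift a b : (a <= b)%N -> al <= gap a.+1 * gap b ->
  gap a.+1 * gap b <= gap a * gap b.+1.
Proof.
move=> leab hab; have ltb := gap_gt hab isT.
have leyx := gap_nonincreasing leab; move: hab => /=.
have lta := lt_le_trans ltb leyx.
rewrite (max_r (ltW lta)) (max_r (ltW ltb)); set x := gap a in leyx lta *; set y := gap b in ltb leyx *.
have [x0 y0] : 0 < x /\ 0 < y by split; [exact: lt_trans lta | exact: lt_trans ltb].
rewrite -(ler_pM2r x0) => hab.
rewrite -(ler_pM2r (mulr_gt0 x0 y0)) -subr_ge0.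
have -> : x * (1 - al / y) * (x * y) - (1 - al / x) * y * (x * y)
    = (x - y) * ((1 - al / x) * y * x - al * x).
  by field; rewrite !gt_eqF.
by rewrite mulr_ge0 // subr_ge0.
Qed.

Lemma gap_shift_iter k a b : (a + k <= b)%N -> al <= gap (a + k) * gap b ->
  gap (a + k) * gap b <= gap a * gap (b + k).
Proof.
elim: k b => [|k IHk] b; first by rewrite !addn0.
rewrite !addnS => leb hab; have le1 := gap_shift (ltnW leb) hab.
apply: (le_trans le1); rewrite -addSn; apply: IHk; first exact: leqW (ltnW leb).
exact: le_trans hab le1.
Qed.

(** Moving all the edges of the smaller branch to the larger one ends with the factor [gap 0 = 1].
    The maximum absorbs the case where the product is too small for the exchange. *)
Lemma gap_merge a b : gap a * gap b <= Num.max al (gap (a + b)).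
Proof.
wlog leab : a b / (a <= b)%N.
  by case: (leqP a b) => [/[swap]|/ltnW /[swap]]; [|rewrite mulrC addnC]; apply.
have [hab|/ltW hab] := leP (gap a * gap b) al; rewrite le_max ?hab//.
have := @gap_shift_iter a 0 b leab hab.
by rewrite add0n mul1r addnC => ->; rewrite orbT.
Qed.

Lemma gap_merge_sum (I : finType) (P : pred I) (n : I -> nat) :
  \prod_(i | P i) gap (n i) <= Num.max al (gap (\sum_(i | P i) n i)).
Proof.
elim/big_rec2: _ => [|i y x _ IH]; first by rewrite le_max lexx orbT.
apply: le_trans (_ : gap (n i) * Num.max al (gap y) <= _).
  by rewrite ler_wpM2l ?gap_ge0.
rewrite maxr_pMr ?gap_ge0// ge_max gap_merge le_max.
by rewrite ler_piMl ?gap_le1// ltW.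
Qed.

(** Let [F = 1 - gap b.+1] be what the second branch takes at the root. By [gap_merge] the merged
    path takes at most [F / gap a], and [F / gap a <= 1 - gap a + F] amounts to
    [(1 - gap a) * (gap a - F) >= 0]. *)
Lemma gap_add a b : gap a + gap b <= 1 + gap (a + b).
Proof.
case: b => [|b]; first by rewrite addn0 addrC.
have [h1|h1] := leP (gap a + gap b.+1) 1.
  by rewrite (le_trans h1)// lerDl gap_ge0.
have a0 : 0 < gap a by have := gapS_lt1 b; lra.
have hmax : gap a * Num.max al (gap b) <= Num.max al (gap (a + b)).
  rewrite maxr_pMr ?gap_ge0// ge_max gap_merge le_max.
  by rewrite ler_piMl ?gap_le1// ltW.
have hF : al / Num.max al (gap (a + b)) <= al / Num.max al (gap b) / gap a.
  rewrite -mulrA -invfM ler_pM2l// lef_pV2 ?posrE ?max_gt0 1?mulrC//.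
  by rewrite mulr_gt0 ?max_gt0.
rewrite addnS /=; set F := al / Num.max al (gap b) in hF *.
set G := al / _ in hF *.
have hb : gap b.+1 = 1 - F by [].
have : F / gap a <= 1 - gap a + F.
  rewrite ler_pdivrMr// -subr_ge0.
  have -> : (1 - gap a + F) * gap a - F = (1 - gap a) * (gap a - F) by ring.
  by rewrite mulr_ge0 ?subr_ge0 ?gap_le1//; lra.
lra.
Qed.

(** All edges but one of a branch pass to another one, twice; the total is preserved, so the sizes
    end as 1, 1 and [a + b + c - 2]. *)
Lemma gap3_edge a b c : (0 < a)%N -> (0 < b)%N -> (0 < c)%N ->
  al <= gap a * gap b * gap c -> al <= gap 1 ^+ 2 * gap (a + b + c - 2).
Proof.
have main p q s : (0 < p)%N -> (p <= q)%N -> al <= gap p * gap q * gap s ->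
    al <= gap 1 * gap (p + q).-1 * gap s.
  case: p => // p _ lepq h; apply: (le_trans h); rewrite ler_wpM2r ?gap_ge0//.
  rewrite addSn [_.+1.-1]/= addnC; apply: (@gap_shift_iter p 1 q) => //.
  by apply: le_trans h _; rewrite ler_piMr ?gap_le1 ?mulr_ge0 ?gap_ge0.
have main' p q s : (0 < p)%N -> (0 < q)%N -> al <= gap p * gap q * gap s ->
    al <= gap 1 * gap (p + q).-1 * gap s.
  move=> p0 q0; case: (leqP p q) => [|/ltnW] le; first exact: main.
  by rewrite (mulrC (gap p)) (addnC p); exact: main.
move=> a0 b0 c0 /(main' _ _ _ a0 b0) h.
have -> : (a + b + c - 2 = ((a + b).-1 + c).-1)%N by lia.
rewrite expr2 mulrAC; apply: main' => //; first by lia.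
by rewrite mulrC mulrA.
Qed.

(** A branching vertex reduces to a branching edge. Some branch has at least two edges, and its
    share [1 - gap a.+2] is [al / Num.max al (gap a.+1)]; as [(1 - gap b) * (1 - gap c) >= 0], this
    share is at most [gap b * gap c]. The edge used up in this way turns the 2 of [gap3_edge] into a
    3. *)
Lemma gap3_vertex a b c : (0 < a)%N -> (0 < b)%N -> (0 < c)%N ->
  (3 < a + b + c)%N -> (1 - gap a) + (1 - gap b) + (1 - gap c) <= 1 ->
  al <= gap 1 ^+ 2 * gap (a + b + c - 3).
Proof.
wlog lt1a : a b c / (1 < a)%N.
  move=> W a0 b0 c0 lt3 h; have [/W|lea] := ltnP 1 a; first exact.
  have [ltb|leb] := ltnP 1 b.
    by rewrite (addnC a b); apply: W => //; [lia | lra].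
  have -> : (a + b + c = c + b + a)%N by lia.
  by apply: W => //; [lia | lia | lra].
case: a lt1a => // -[//|a] _ _ b0 c0 _ h.
have -> : (a.+2 + b + c - 3 = a.+1 + b + c - 2)%N by lia.
apply: gap3_edge => //.
have hbc : al / Num.max al (gap a.+1) <= gap b * gap c.
  have := mulr_ge0 (_ : 0 <= 1 - gap b) (_ : 0 <= 1 - gap c).
  rewrite !subr_ge0 !gap_le1 => /(_ isT isT); move: h => /=; lra.
move: hbc; rewrite ler_pdivrMr ?max_gt0//.
rewrite maxr_pMr ?mulr_ge0 ?gap_ge0// le_max => /orP[hal|]; last by rewrite mulrC mulrA.
suff : gap b * gap c * al < al by rewrite ltNge hal.
rewrite gtr_pMl//; apply: le_lt_trans (gap_lt1 b0).
by rewrite ler_piMr ?gap_le1 ?gap_ge0.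
Qed.

(** Each of two exchanges empties a branch of size 1, leading from sizes 1, 1, n to a single path.
    The first one is strict because [gap n < 1]. *)
Lemma gap_of_gap3 n : (0 < n)%N -> al <= gap 1 ^+ 2 * gap n ->
  al < gap n.+2.
Proof.
move=> n0; rewrite expr2 -mulrA => h.
have hn : al < gap n.
  apply: (gap_gt (a := 1)) => //; apply: le_trans h _.
  by rewrite ler_piMl ?gap_le1 ?mulr_ge0 ?gap_ge0.
have al1 : al < 1 := lt_le_trans hn (gap_le1 n).
have g1 : gap 1 = 1 - al by rewrite /= max_r ?ltW// divr1.
have g1_gt0 : 0 < gap 1 by rewrite g1; lra.
have hlt : gap 1 * gap n < gap n.+1.
  rewrite [gap n.+1]/= (max_r (ltW hn)) g1; move: (gap_lt1 n0) (h) (hn); rewrite g1.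
  set y := gap n => y1 hy hny; have y0 : 0 < y := lt_trans al_gt0 hny.
  rewrite -(ltr_pM2r y0) -subr_gt0.
  have -> : (1 - al / y) * y - (1 - al) * y * y = (1 - y) * ((1 - al) * y - al).
    by field; rewrite gt_eqF.
  rewrite mulr_gt0 ?subr_gt0//; apply: le_lt_trans hy _.
  by rewrite gtr_pMl ?mulr_gt0 ?subr_gt0// gtrBl.
have h1 : al < gap 1 * gap n.+1 by apply: le_lt_trans h _; rewrite ltr_pM2l.
apply: (lt_le_trans h1); have := @gap_shift 0 n.+1 isT (ltW h1).
by rewrite mul1r.
Qed.

End Gaps.

(** * Branches of an acyclic hypergraph *)

Lemma connect_invariant (T : finType) (e : rel T) (P : T -> Prop) (x : T) :
  P x -> (forall y z, P y -> e y z -> P z) -> forall y, connect e x y -> P y.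
Proof.
move=> Px Pe y /connectP[p e_p ->]; elim: p x Px e_p => //= z p IHp x Px.
by case/andP=> e_xz; apply: IHp; apply: Pe e_xz.
Qed.

Section Components.

Variable V : finType.
Implicit Types (E F : {set {set V}}) (e f : {set V}) (u v w : V).

Lemma adjacentP E u v :
  reflect (exists e, [/\ e \in E, u \in e & v \in e]) (adjacent E u v).
Proof.
apply: (iffP existsP) => [[e /and3P[? ? ?]]|[e [? ? ?]]]; exists e => //.
exact/and3P.
Qed.

Lemma adjacent_sym E : symmetric (adjacent E).
Proof. by move=> u v; apply/adjacentP/adjacentP => -[e []]; exists e. Qed.

Lemma connect_adjacent_sym E : connect_sym (adjacent E).
Proof. exact/sym_connect_sym/adjacent_sym. Qed.

Lemma adjacent_subset E F : E \subset F -> subrel (adjacent E) (connect (adjacent F)).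
Proof.
move=> /subsetP sEF u v /adjacentP[e [eE ue ve]].
by apply/connect1/adjacentP; exists e; rewrite sEF.
Qed.

Lemma acyclic_subset E F : F \subset E -> acyclic E -> acyclic F.
Proof.
move=> /subsetP sFE acE n v e [n2 vI eI eF vE]; apply: (acE n v e).
by split=> // i; apply: sFE.
Qed.

(** For [u] in [e], the branch hanging from [e] at [u] is [component (E :\ e) u]. It is a set of
    edges over the same vertex type, where the vertices left out merely become isolated;
    [component E v = E] therefore replaces connectedness in the inductions. *)
Definition component F u : {set {set V}} :=
  [set f in F | [exists w in f, connect (adjacent F) u w]].

Lemma componentP F u f :
  reflect (f \in F /\ exists2 w, w \in f & connect (adjacent F) u w)
          (f \in component F u).
Proof.
rewrite inE; apply: (iffP andP) => -[fF].
  by case/existsP=> w /andP[? ?]; split=> //; exists w.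
by case=> w ? ?; split=> //; apply/existsP; exists w; apply/andP.
Qed.

Lemma component_subset F u : component F u \subset F.
Proof. by apply/subsetP => f /componentP[]. Qed.

Lemma mem_component F u f : f \in F -> u \in f -> f \in component F u.
Proof. by move=> fF uf; apply/componentP; split=> //; exists u. Qed.

Lemma component_component F u : component (component F u) u = component F u.
Proof.
apply/eqP; rewrite eqEsubset component_subset; apply/subsetP => f fC.
apply/componentP; split=> //; have /componentP[fF [w wf uw]] := fC; exists w => //.
elim/connect_invariant: w / uw {f fC fF wf} => [|w w' uw /adjacentP[f [fF wf w'f]]].
  exact: connect0.
apply: (connect_trans uw); apply/connect1/adjacentP; exists f; split=> //.
apply/componentP; split=> //; exists w => //.
by apply: connect_sub uw => x y; apply/adjacent_subset/component_subset.
Qed.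

Lemma component_connected E v : connected_hypergraph E ->
  (forall e, e \in E -> e != set0) -> component E v = E.
Proof.
move=> cE E0; apply/eqP; rewrite eqEsubset component_subset; apply/subsetP => f fE.
by apply/componentP; split=> //; have /set0Pn[w wf] := E0 _ fE; exists w.
Qed.

Lemma component_neq0 F u : component F u != set0 -> exists2 e, e \in F & u \in e.
Proof.
case/set0Pn=> f /componentP[fF [w wf /connectP[[|x p] /=]]].
  by move=> _ wu; exists f; rewrite // -wu.
by case/andP=> /adjacentP[e [eF ue _]] _ _; exists e.
Qed.

(* A shortest path avoiding [e] between two vertices of [e] would close up to a
   cycle with [e]. *)
Lemma acyclic_connect_edge E e u u' : acyclic E -> e \in E ->
  u \in e -> u' \in e -> connect (adjacent (E :\ e)) u u' -> u = u'.
Proof.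
move=> acE eE ue u'e uu'; apply/eqP; apply: contraT => neq_uu'.
set F := E :\ e in uu'.
pose P n := [exists p : n.-tuple V, path (adjacent F) u p && (last u p == u')].
have exP : exists n, P n.
  case/connectP: uu' => p e_p lastp; exists (size p); apply/existsP.
  by exists (in_tuple p); rewrite e_p /= -lastp eqxx.
case: (ex_minnP exP) => n /existsP[[p /= /eqP szp] /andP[e_p /eqP lastp]] minP.
have {}minP q : path (adjacent F) u q -> last u q = u' -> (n <= size q)%N.
  move=> e_q last_q; apply: minP; apply/existsP; exists (in_tuple q).
  by rewrite e_q last_q eqxx.
have Up : uniq (u :: p).
  case/shortenP: e_p (lastp) => q e_q Uq sub_qp lastq.
  apply: leq_size_uniq Uq _ _; last by rewrite /= szp ltnS; exact: minP.
  by move=> w; rewrite !inE => /orP[->//|/sub_qp ->]; rewrite orbT.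
(* On a shortest path only consecutive vertices are adjacent: otherwise [q], which takes the chord,
   would be shorter. *)
have chord i j : (i < j <= n)%N ->
    adjacent F (nth u (u :: p) i) (nth u (u :: p) j) -> j = i.+1.
  case/andP=> lt_ij le_jn adj_ij; apply/eqP; rewrite eqn_leq lt_ij andbT leqNgt.
  apply/negP => lt_Sij; pose q := take i p ++ drop j.-1 p.
  have lt_jp : (j.-1 < size p)%N by rewrite szp; lia.
  have sz_i : size (take i p) = i by rewrite size_takel // szp; lia.
  have last_i : last u (take i p) = nth u (u :: p) i.
    by rewrite (last_nth u) sz_i -[u :: take i p]/(take i.+1 (u :: p)) nth_take.
  have drop_j : drop j.-1 p = nth u (u :: p) j :: drop j p.
    by rewrite (drop_nth u lt_jp) prednK //; [case: (j) lt_ij | lia].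
  have := e_p; rewrite -(cat_take_drop j.-1 p) cat_path drop_j /= => /and3P[_ _ e_j].
  have := e_p; rewrite -(cat_take_drop i p) cat_path => /andP[e_i _].
  have : (n <= size q)%N.
    apply: minP; first by rewrite /q cat_path e_i last_i drop_j /= adj_ij.
    by rewrite -lastp -(cat_take_drop j.-1 p) !last_cat drop_j.
  rewrite size_cat sz_i size_drop szp; lia.
pose g i := odflt set0
  [pick f in F | (nth u (u :: p) i \in f) && (nth u p i \in f)].
have gP i : (i < n)%N ->
    [/\ g i \in F, nth u (u :: p) i \in g i & nth u p i \in g i].
  move=> lt_in; have := pathP u e_p i; rewrite szp => /(_ lt_in) /adjacentP[f [fF vf wf]].
  by rewrite /g; case: pickP => [? /and3P[]//|/(_ f)/and3P[]].
have n_gt0 : (0 < n)%N.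
  case: n szp {minP chord gP g} => //; case: p {e_p Up} lastp => //= eq_uu'.
  by rewrite eq_uu' eqxx in neq_uu'.
(* A repeated edge would join the vertices at positions [i] and [j.+1], which is a chord. *)
have gI i j : (i < j < n)%N -> g i != g j.
  case/andP=> lt_ij lt_jn; apply/negP => /eqP gij.
  have [gF vi _] := gP _ (ltn_trans lt_ij lt_jn).
  have [_ _ vj] := gP _ lt_jn.
  have adj_ij : adjacent F (nth u (u :: p) i) (nth u (u :: p) j.+1).
    by apply/adjacentP; exists (g i); split; rewrite // gij.
  have [eq_ij] : j.+1 = i.+1 by apply: chord adj_ij; rewrite ltnS (ltnW lt_ij).
  by rewrite eq_ij ltnn in lt_ij.
pose vv (i : 'I_n.+1) := nth u (u :: p) i.
pose ee (i : 'I_n.+1) := if (i < n)%N then g i else e.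
case: (acE n.+1 vv ee); split=> //.
- move=> i j /eqP; rewrite nth_uniq ?[size _]/= ?szp ?ltn_ord// => /eqP.
  exact: val_inj.
- have eeI (i j : 'I_n.+1) : (i < j)%N -> ee i != ee j.
    move=> lt_ij; have lt_in : (i < n)%N by have := ltn_ord j; lia.
    rewrite /ee lt_in; case: ifP => [lt_jn|_]; first by apply: gI; rewrite lt_ij.
    by have [/setD1P[]] := gP _ lt_in.
  move=> i j /eqP; case: (ltngtP i j) => [/eeI/negPf ->|/eeI|/val_inj //] //.
  by rewrite eq_sym => /negPf ->.
- by move=> i; rewrite /ee; case: ifP => // /gP[/setD1P[]].
move=> i; rewrite /vv /ee; case: ifPn => [lt_in|].
  by rewrite /= modn_small ?ltnS//; case: (gP i lt_in).
rewrite -leqNgt => le_ni; have i_n : i = n :> nat by have := ltn_ord i; lia.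
have -> : ordS i = 0%N :> nat by rewrite -[LHS]/(i.+1 %% n.+1)%N i_n modnn.
by rewrite i_n -[n]szp nth_last /= lastp.
Qed.

(** An edge in both branches would connect [u] to [u'] without [e]. Hence the branches at distinct
    vertices of [e] are disjoint and their sizes add up. *)
Lemma component_inj E e u u' f : acyclic E -> e \in E -> u \in e -> u' \in e ->
  f \in component (E :\ e) u -> f \in component (E :\ e) u' -> u = u'.
Proof.
move=> acE eE ue u'e /componentP[fF [w wf uw]] /componentP[_ [w' w'f uw']].
apply: (acyclic_connect_edge acE eE) => //; apply: connect_trans uw _.
rewrite connect_adjacent_sym; apply: connect_trans uw' _.
by apply/connect1/adjacentP; exists f.
Qed.

(** Along the walk, [u'] is the last vertex reached through [e]; each passage through [e] resets
    it. *)
Lemma connect_split E e u w : u \in e -> connect (adjacent E) u w ->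
  exists2 u', u' \in e & connect (adjacent (E :\ e)) u' w.
Proof.
move=> ue; elim/connect_invariant: w /; first by exists u.
move=> w w' [u' u'e uw] /adjacentP[f [fE wf w'f]].
have [fe|fNe] := eqVneq f e; first by exists w'; rewrite -?fe.
exists u' => //; apply: connect_trans uw _; apply/connect1/adjacentP.
by exists f; rewrite !inE fNe.
Qed.

Lemma bigcup_component E e v : e \in E -> v \in e -> component E v = E ->
  \bigcup_(u in e) component (E :\ e) u = E :\ e.
Proof.
move=> eE ve cE; apply/eqP; rewrite eqEsubset; apply/andP; split.
  by apply/bigcupsP => u _; exact: component_subset.
apply/subsetP => f fF; have /setD1P[_] := fF; rewrite -{1}cE.
case/componentP=> _ [w wf /(connect_split ve)[u ue uw]].
by apply/bigcupP; exists u => //; apply/componentP; split=> //; exists w.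
Qed.

Lemma card_component E e v : acyclic E -> e \in E -> v \in e -> component E v = E ->
  #|E| = (\sum_(u in e) #|component (E :\ e) u|).+1.
Proof.
move=> acE eE ve cE; rewrite (cardsD1 e) eE add1n; congr _.+1.
rewrite -[in LHS](bigcup_component eE ve cE) [X in pred_of_set X]big_mkcond -sum1_card /=.
rewrite partition_disjoint_bigcup => [|u u' neq_uu'].
  rewrite [RHS]big_mkcond /=; apply: eq_bigr => u _.
  by case: ifP => _; rewrite sum1_card ?cards0.
case: ifP => ue; last by rewrite -setI_eq0 set0I.
case: ifP => u'e; last by rewrite -setI_eq0 setI0.
apply/pred0P => f /=; apply: contraNF neq_uu' => /andP[fu fu'].
exact/eqP/(component_inj acE eE ue u'e fu fu').
Qed.

End Components.

(** * What the labels of a branch take from its root *)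

Section BranchBounds.

Variables (R : realFieldType) (al : R) (V : finType) (B : V -> {set V} -> R).
Hypothesis al_gt0 : 0 < al.
Implicit Types (E : {set {set V}}) (e f : {set V}) (u v w : V).

(** Nothing bounds the sum at the root [v]: this sum is what [branch_bound] estimates from below. *)
Definition subnormal_labels E v := [/\ forall u e, 0 <= B u e,
  forall e, e \in E -> \prod_(u in e) B u e = al
  & forall u, u != v -> \sum_(f in E | u \in f) B u f <= 1].

Lemma subnormal_component E e u v : acyclic E -> e \in E -> u \in e -> v \in e ->
  subnormal_labels E v -> subnormal_labels (component (E :\ e) u) u.
Proof.
move=> acE eE ue ve [B0 Bprod Bsum]; split=> //.
  by move=> f /componentP[/setD1P[_ /Bprod]].
move=> w neq_wu; have [eq_wv|neq_wv] := eqVneq w v; last first.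
  apply: le_trans (Bsum _ neq_wv); rewrite [leRHS]big_mkcond [leLHS]big_mkcond.
  apply: ler_sum => f _; case: ifP => [/andP[/componentP[/setD1P[_ ->]] _ ->]|_] //.
  by case: ifP.
(* The old root [v] is another vertex of [e], so no edge of the branch at [u] contains it and the
   sum is empty. *)
rewrite eq_wv in neq_wu *; rewrite big1 ?ler01// => f /andP[fC vf].
have /componentP[fF _] := fC.
have := component_inj acE eE ue ve fC (mem_component fF vf).
by move=> eq_uv; rewrite eq_uv eqxx in neq_wu.
Qed.

Lemma sum_split_edge E e u : e \in E -> u \in e ->
  \sum_(f in E | u \in f) B u f
    = B u e + \sum_(f in component (E :\ e) u | u \in f) B u f.
Proof.
move=> eE ue; rewrite (bigD1 e) ?eE//=; congr (_ + _); apply: eq_bigl => f.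
apply/idP/idP => [/andP[/andP[fE uf] neq_fe]|/andP[/componentP[/setD1P[-> ->]] _ ->]] //.
by rewrite uf andbT mem_component // !inE neq_fe.
Qed.

Lemma label_le_gap E e u v : acyclic E -> e \in E -> u \in e -> u != v ->
  subnormal_labels E v ->
  1 - gap al #|component (E :\ e) u|
    <= \sum_(f in component (E :\ e) u | u \in f) B u f ->
  B u e <= gap al #|component (E :\ e) u|.
Proof.
move=> acE eE ue neq_uv [_ _ /(_ u neq_uv)]; rewrite (sum_split_edge eE ue); lra.
Qed.

(** Every other vertex of [e] leaves at most the gap of its branch, and these gaps merge into that
    of [N] edges. The product condition then forces [B v e] to be at least
    [al / Num.max al (gap al N)], which is [1 - gap al N.+1]. The bounds on the branches are
    hypotheses because the lemma serves inside the induction that proves them. *)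
Lemma edge_bound_of_components E e v : acyclic E -> component E v = E ->
    e \in E -> v \in e -> subnormal_labels E v ->
    (forall u, u \in e -> 1 - gap al #|component (E :\ e) u|
      <= \sum_(f in component (E :\ e) u | u \in f) B u f) ->
  1 - gap al (#|E| - #|component (E :\ e) v|) <= B v e.
Proof.
move=> acE cE eE ve BE IH; have [B0 Bprod _] := BE.
rewrite (card_component acE eE ve cE) (bigD1 v) //= subSn ?leq_addr// addKn /=.
rewrite opprB addrC subrK; set N := (\sum_(i in e | _) _)%N.
have max_gt0 : 0 < Num.max al (gap al N) by rewrite lt_max al_gt0.
rewrite ler_pdivrMr// -{1}(Bprod _ eE) (bigD1 v) //= ler_wpM2l//.
apply: le_trans (gap_merge_sum al_gt0 _ _); apply: ler_prod => u /andP[ue neq_uv].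
by rewrite B0 (label_le_gap acE eE ue neq_uv BE) ?IH.
Qed.

(** Induction on the number of edges: some edge [e] at [v] takes its share by the previous lemma,
    the rest of the tree at [v] takes its own by induction, and [gap_add] joins the two. *)
Lemma branch_bound E v : acyclic E -> component E v = E -> subnormal_labels E v ->
  1 - gap al #|E| <= \sum_(e in E | v \in e) B v e.
Proof.
have [n] := ubnP #|E|; elim: n E v => // n IHn E v ltEn acE cE BE.
have [E0|E_neq0] := eqVneq E set0.
  by rewrite E0 cards0 subrr big1 // => e; rewrite inE.
have [e eE ve] : exists2 e, e \in E & v \in e.
  by apply: component_neq0; rewrite cE.
have IH u : u \in e -> 1 - gap al #|component (E :\ e) u|
    <= \sum_(f in component (E :\ e) u | u \in f) B u f.
  move=> ue; apply: IHn; last exact: subnormal_component ve BE.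
  - rewrite -ltnS; apply: leq_trans ltEn; rewrite (cardsD1 e E) eE !ltnS.
    exact/subset_leq_card/component_subset.
  - apply: acyclic_subset acE; exact/(subset_trans (component_subset _ _))/subsetDl.
  - exact: component_component.
have := edge_bound_of_components acE cE eE ve BE IH.
rewrite (sum_split_edge eE ve); have := IH v ve.
set k := #|component _ v|; have := gap_add al_gt0 (#|E| - k) k; rewrite subnK; first lra.
exact/subset_leq_card/(subset_trans (component_subset _ _))/subsetDl.
Qed.

Lemma component_bound E e u v : acyclic E -> e \in E -> u \in e -> v \in e ->
    subnormal_labels E v ->
  1 - gap al #|component (E :\ e) u|
    <= \sum_(f in component (E :\ e) u | u \in f) B u f.
Proof.
move=> acE eE ue ve BE; apply: branch_bound.
- apply: acyclic_subset acE; exact/(subset_trans (component_subset _ _))/subsetDl.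
- exact: component_component.
- exact: subnormal_component ve BE.
Qed.

Lemma edge_bound E e v : acyclic E -> component E v = E ->
    e \in E -> v \in e -> subnormal_labels E v ->
  1 - gap al (#|E| - #|component (E :\ e) v|) <= B v e.
Proof.
move=> acE cE eE ve BE; apply: edge_bound_of_components => // u ue.
exact: component_bound ve BE.
Qed.

End BranchBounds.

(** * Branching edges and vertices force the bound on [al] *)

Section Branching.

Variables (R : realFieldType) (al : R) (V : finType) (B : V -> {set V} -> R).
Variable E : {set {set V}}.
Hypotheses (al_gt0 : 0 < al) (acE : acyclic E).
Hypothesis componentE : forall v, component E v = E.
Hypothesis labelsE : forall v, subnormal_labels al B E v.
Hypothesis sum_le1 : forall v, \sum_(f in E | v \in f) B v f <= 1.

(** The branches at all vertices of [e] other than [u1] and [u2] are merged into a third one of size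
    [N], positive because of [u3]. The truncated case of the merge would make [al] smaller than
    itself, as [gap al (n u1) < 1]. *)
Lemma gap3_of_edge e u1 u2 u3 : e \in E -> u1 \in e -> u2 \in e -> u3 \in e ->
    uniq [:: u1; u2; u3] ->
    (forall u, u \in [:: u1; u2; u3] -> exists2 f, f \in E :\ e & u \in f) ->
  al <= gap al 1 ^+ 2 * gap al (#|E| - 3).
Proof.
move=> eE u1e u2e u3e /= /and3P[]; rewrite !inE negb_or.
case/andP=> neq12 neq13 neq23 _ deg.
pose n u := #|component (E :\ e) u|.
have n_gt0 u : u \in [:: u1; u2; u3] -> (0 < n u)%N.
  by case/deg=> f fF uf; apply/card_gt0P; exists f; exact: mem_component.
have [B0 Bprod _] := labelsE u1.
have hal : al <= \prod_(u in e) gap al (n u).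
  rewrite -{1}(Bprod _ eE); apply: ler_prod => u ue; rewrite B0 /=.
  have := component_bound al_gt0 acE eE ue u1e (labelsE u1).
  have := sum_le1 u; rewrite (sum_split_edge _ eE ue) -/(n u); lra.
have := card_component acE eE u1e (componentE u1); rewrite -/n.
move: hal; rewrite (bigD1 u1) //= (bigD1 u2) ?u2e 1?eq_sym //= => hal.
rewrite (bigD1 u1) //= (bigD1 u2) ?u2e 1?eq_sym//=.
set N := (\sum_(i | _) _)%N => cardE.
have N_gt0 : (0 < N)%N.
  rewrite /N (bigD1 u3) /= ?u3e 1?eq_sym ?neq13 1?eq_sym ?neq23//.
  by rewrite addn_gt0 -/(n u3) n_gt0 // !inE eqxx !orbT.
have g1 := gap_lt1 al_gt0 (n_gt0 u1 (mem_head _ _)).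
have g2 := gap_le1 al_gt0 (n u2).
have hal' : al <= gap al (n u1) * gap al (n u2) * gap al N.
  move: hal (gap_merge_sum al_gt0 (fun u => (u \in e) && (u != u1) && (u != u2)) n).
  have g12 := mulr_ge0 (gap_ge0 al_gt0 (n u1)) (gap_ge0 al_gt0 (n u2)).
  rewrite mulrA -/N => hal /(ler_wpM2l g12).
  move/(le_trans hal); rewrite maxr_pMr ?mulr_ge0 ?gap_ge0// le_max => /orP[|//].
  rewrite leNgt gtr_pMl// => /negP[]; apply: le_lt_trans g1.
  by rewrite ler_piMr ?gap_ge0.
have -> : (#|E| - 3 = n u1 + n u2 + N - 2)%N by rewrite cardE -addnA !subSS.
by apply: gap3_edge => //; apply: n_gt0; rewrite !inE eqxx ?orbT.
Qed.

(** The tree is cut at [v] into the part through [e1], the part through [e2] and everything else,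
    which contains [e3]; this covers all degrees from three on. *)
Lemma gap3_of_vertex v e1 e2 e3 : (3 < #|E|)%N -> uniq [:: e1; e2; e3] ->
    (forall e, e \in [:: e1; e2; e3] -> (e \in E) && (v \in e)) ->
  al <= gap al 1 ^+ 2 * gap al (#|E| - 3).
Proof.
move=> lt3E /= /and3P[]; rewrite !inE negb_or => /andP[neq12 neq13] neq23 _ deg.
have /andP[e1E ve1] := deg e1 (mem_head _ _).
have /andP[e2E ve2] : (e2 \in E) && (v \in e2) by apply: deg; rewrite !inE eqxx orbT.
have /andP[e3E ve3] : (e3 \in E) && (v \in e3) by apply: deg; rewrite !inE eqxx !orbT.
pose E1 := component (E :\ e1) v; pose E2 := component (E1 :\ e2) v.
have sE1 : E1 \subset E := subset_trans (component_subset _ _) (subsetDl _ _).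
have acE1 := acyclic_subset sE1 acE.
have e2E1 : e2 \in E1 by apply: mem_component; rewrite // !inE eq_sym neq12.
have e3E1 : e3 \in E1 by apply: mem_component; rewrite // !inE eq_sym neq13.
have e3E2 : e3 \in E2 by apply: mem_component; rewrite // in_setD1 eq_sym neq23.
have B1 := subnormal_component acE e1E ve1 ve1 (labelsE v).
have cE1 : component E1 v = E1 := component_component _ _.
have B2 := subnormal_component acE1 e2E1 ve2 ve2 B1.
have h1 := edge_bound al_gt0 acE (componentE v) e1E ve1 (labelsE v).
have h2 := edge_bound al_gt0 acE1 cE1 e2E1 ve2 B1.
have h3 := component_bound al_gt0 acE1 e2E1 ve2 ve2 B1.
have := sum_le1 v; rewrite (sum_split_edge _ e1E ve1) (sum_split_edge _ e2E1 ve2).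
move=> hsum.
have lt1 : (#|E1| < #|E|)%N.
  apply: leq_ltn_trans (subset_leq_card (component_subset _ _)) _.
  by rewrite (cardsD1 e1 E) e1E.
have lt2 : (#|E2| < #|E1|)%N.
  apply: leq_ltn_trans (subset_leq_card (component_subset _ _)) _.
  by rewrite (cardsD1 e2 E1) e2E1.
have lt3 : (0 < #|E2|)%N by apply/card_gt0P; exists e3.
have cardE : ((#|E| - #|E1|) + (#|E1| - #|E2|) + #|E2| = #|E|)%N.
  by rewrite -addnA !subnK // ltnW.
have := @gap3_vertex _ _ al_gt0 (#|E| - #|E1|) (#|E1| - #|E2|) #|E2|.
rewrite cardE !subn_gt0; apply=> //.
move: h1 h2 h3 hsum; rewrite -/E1 -/E2.
set s := \sum_(f in E2 | _) _; move: (gap _ _) (gap _ _) (gap _ _) s => g1 g2 g3 s.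
lra.
Qed.

End Branching.

(** * A positive eigenvector by maximization *)

Section EdgeForm.

Variables (R : realType) (V : finType) (E : {set {set V}}) (r : nat).
Implicit Types (x y : V -> R) (v w : V) (e : {set V}).

Definition edge_form x : R := \sum_(e in E) \prod_(v in e) x v.

Definition power_sum x : R := \sum_v x v ^+ r.

Lemma edge_formZ c x : uniform r E ->
  edge_form (fun v => c * x v) = c ^+ r * edge_form x.
Proof.
move=> Er; rewrite /edge_form mulr_sumr; apply: eq_bigr => e eE.
by rewrite big_split prodr_const /= Er.
Qed.

Lemma power_sumZ c x : power_sum (fun v => c * x v) = c ^+ r * power_sum x.
Proof. by rewrite /power_sum mulr_sumr; apply: eq_bigr => v _; rewrite exprMn. Qed.

Lemma continuous_bigsum (T : topologicalType) (I : finType) (P : pred I)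
    (F : I -> T -> R) :
  (forall i, continuous (F i)) -> continuous (fun t => \sum_(i | P i) F i t).
Proof.
move=> cF t; elim: (index_enum I) => [|i s IHs].
  by under eq_fun do rewrite big_nil; rewrite ?big_nil; exact: cvg_cst.
under eq_fun do rewrite big_cons; rewrite ?big_cons.
by case: (P i) => //; apply: cvgD => //; exact: cF.
Qed.

Lemma continuous_bigprod (T : topologicalType) (I : finType) (P : pred I)
    (F : I -> T -> R) :
  (forall i, continuous (F i)) -> continuous (fun t => \prod_(i | P i) F i t).
Proof.
move=> cF t; elim: (index_enum I) => [|i s IHs].
  by under eq_fun do rewrite big_nil; rewrite ?big_nil; exact: cvg_cst.
under eq_fun do rewrite big_cons; rewrite ?big_cons.
by case: (P i) => //; apply: cvgM => //; exact: cF.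
Qed.

(** The maximum is taken over the compact cube of vectors with entries in [0, 1], with the
    denominator [Num.max 1 (power_sum x)], which is continuous and never zero. A nonzero vector
    scaled to have largest entry 1 has power sum at least 1, so the bound reaches all nonnegative
    vectors. *)
Lemma ratio_max : (0 < r)%N -> uniform r E -> E != set0 ->
  exists (k : R) (x : V -> R), [/\ 0 < k, forall v, 0 <= x v, 1 <= power_sum x,
    edge_form x = k * power_sum x
    & forall y, (forall v, 0 <= y v) -> edge_form y <= k * power_sum y].
Proof.
move=> r_gt0 Er /set0Pn[e0 e0E].
pose coord (M : 'rV[R]_#|V|) v : R := M ord0 (enum_rank v).
have ccoord v : continuous (coord ^~ v) by move=> M; exact: coord_continuous.
pose cube := [set M : 'rV[R]_#|V| | forall i, `[0, 1]%classic (M ord0 i)]%classic.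
pose ratio M := edge_form (coord M) / Num.max 1 (power_sum (coord M)).
have max_gt0 (a : R) : 0 < Num.max 1 a by rewrite lt_max ltr01.
have cform : continuous (fun M => edge_form (coord M)).
  apply: (continuous_bigsum (F := fun e M => \prod_(v in e) coord M v)) => e.
  exact: continuous_bigprod.
have csum : continuous (fun M => power_sum (coord M)).
  apply: (continuous_bigsum (F := fun v M => coord M v ^+ r)) => v.
  rewrite (_ : (fun M => _) = fun M => \prod_(i < r) coord M v).
    exact: (continuous_bigprod (F := fun=> coord ^~ v)).
  by apply/funext => M; rewrite prodr_const card_ord.
have cratio : {within cube, continuous ratio}%classic.
  apply: continuous_subspaceT => M.
  apply: (@continuousM _ _ _ (fun M => (Num.max 1 (power_sum (coord M)))^-1)).
    exact: cform.
  apply: continuousV; first by rewrite gt_eqF.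
  by apply: (@continuous_max _ _ (fun=> 1)); [exact: cst_continuous | exact: csum].
have cube0 : (cube !=set0)%classic.
  by exists (const_mx 0) => i /=; rewrite mxE in_itv /= lexx ler01.
have ccube : compact cube.
  by apply: (@rV_compact _ _ (fun=> `[0 : R, 1]%classic)) => _; exact: segment_compact.
have [M Mcube Mmax] := EVT_max_rV cube0 ccube cratio.
have {Mmax}Mmax y : (forall v, 0 <= y v <= 1) ->
    edge_form y / Num.max 1 (power_sum y) <= ratio M.
  move=> y01; have eqy : coord (\row_i y (enum_val i)) = y.
    by apply/funext => v; rewrite /coord mxE enum_rankK.
  rewrite -{1 2}eqy; apply/Mmax/mem_set => i /=.
  by rewrite mxE in_itv /= y01.
have x01 v : 0 <= coord M v <= 1.
  by have := set_mem Mcube (enum_rank v); rewrite /= in_itv.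
have x0 v : 0 <= coord M v by case/andP: (x01 v).
have k_gt0 : 0 < ratio M.
  apply: lt_le_trans (Mmax (fun=> 1) _); last by move=> v; rewrite ler01 lexx.
  rewrite divr_gt0//; apply: lt_le_trans ltr01 _; rewrite /edge_form (bigD1 e0)//= big1//.
  by rewrite lerDl sumr_ge0 // => e _; rewrite big1.
have bound y : (forall v, 0 <= y v) -> edge_form y <= ratio M * power_sum y.
  move=> y0; have [v y_max] : exists v, forall w, y w <= y v.
    have /card_gt0P[v0 _] : (0 < #|e0|)%N by rewrite Er.
    by case: (@Order.TotalTheory.arg_maxP _ _ _ v0 xpredT y isT) => v _ yv;
      exists v => w; exact: yv.
  have [yv0|yv_neq0] := eqVneq (y v) 0.
    have y00 w : y w = 0 by apply/eqP; rewrite eq_le y0 andbT -yv0.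
    rewrite /power_sum big1 => [|w _]; last by rewrite y00 expr0n gtn_eqF.
    rewrite mulr0 /edge_form big1// => e eE.
    have /card_gt0P[w we] : (0 < #|e|)%N by rewrite Er.
    by rewrite (bigD1 w) //= y00 mul0r.
  have yv_gt0 : 0 < y v by rewrite lt_neqAle eq_sym yv_neq0 y0.
  have := Mmax (fun w => (y v)^-1 * y w); rewrite edge_formZ // power_sumZ => h.
  have {h}/h : forall w, 0 <= (y v)^-1 * y w <= 1.
    by move=> w; rewrite mulr_ge0 ?invr_ge0//= mulrC ler_pdivrMr// mul1r.
  rewrite max_r; last first.
    rewrite /power_sum (bigD1 v) //= mulrDr -exprMn mulVf // expr1n lerDl.
    by rewrite mulr_ge0 ?exprn_ge0 ?invr_ge0 ?sumr_ge0 // => w _; rewrite exprn_ge0.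
  rewrite -mulf_div divff ?mul1r; last by rewrite expf_neq0 // invr_neq0.
  rewrite ler_pdivrMr // /power_sum (bigD1 v) //=.
  by rewrite ltr_wpDr ?exprn_gt0 ?sumr_ge0 // => w _; rewrite exprn_ge0.
exists (ratio M), (coord M).
have hM : edge_form (coord M) = ratio M * Num.max 1 (power_sum (coord M)).
  by rewrite /ratio divfK // gt_eqF.
(* The bound applied to the maximizer itself shows that its denominator was its power sum. *)
have le1 : 1 <= power_sum (coord M).
  have := bound _ x0; rewrite hM ler_pM2l// ge_max => /andP[//].
split=> //; by rewrite hM max_r.
Qed.

Lemma expr1D_le n : exists2 K : R, 0 <= K &
  forall s, `|s| <= 1 -> (1 + s) ^+ n <= 1 + n%:R * s + K * s ^+ 2.
Proof.
elim: n => [|n [K K0 IH]].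
  by exists 0 => // s _; rewrite expr0 !mul0r !addr0.
exists (n%:R + K *+ 2) => [|s s1]; first by rewrite addr_ge0 ?mulrn_wge0.
have := IH s s1; move: s1; rewrite ler_norml => /andP[s_ge s_le] h.
rewrite exprSr; apply: le_trans (ler_wpM2r _ h) _; first by lra.
rewrite -natr1 -subr_ge0; set m := n%:R.
have -> : 1 + (m + 1) * s + (m + K *+ 2) * s ^+ 2
    - (1 + m * s + K * s ^+ 2) * (1 + s) = K * s ^+ 2 * (1 - s) by ring.
apply: mulr_ge0; last by rewrite subr_ge0.
by apply: mulr_ge0 => //; exact: sqr_ge0.
Qed.

(** A line below a curve that it meets at 0 is tangent there. By the quadratic bound of [expr1D_le],
    [d * s <= a * K * s ^+ 2] for small [s]; the point [s = d / M] with [M > a * K] contradicts this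
    unless [d = 0]. *)
Lemma tangent_slope n (a b : R) : 0 <= a ->
  (forall s, `|s| <= 1 -> b * s <= a * ((1 + s) ^+ n - 1)) -> b = a * n%:R.
Proof.
move=> a0 h; have [K K0 hK] := expr1D_le n.
apply/eqP; rewrite -subr_eq0; set d := b - _; apply/negPn/negP => d0.
pose M := `|d| + a * K + 1; have aK0 : 0 <= a * K by rewrite mulr_ge0.
have M0 : 0 < M by rewrite ltr_wpDl ?addr_ge0.
have s1 : `|d / M| <= 1.
  by rewrite normrM normfV (gtr0_norm M0) ler_pdivrMr// mul1r /M -addrA lerDl; lra.
have h1 := h _ s1; have h2 := ler_wpM2l a0 (hK _ s1).
have : d * (d / M) <= a * K * (d / M) ^+ 2.
  move: h1 h2; rewrite /d; set s := (b - _) / M; lra.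
have -> : d * (d / M) = d ^+ 2 / M by rewrite expr2 mulrA.
have -> : a * K * (d / M) ^+ 2 = d ^+ 2 / M * (a * K / M).
  by field; rewrite gt_eqF.
rewrite -subr_ge0 -{2}[d ^+ 2 / M]mulr1 -mulrBr.
rewrite pmulr_rge0 ?divr_gt0 ?exprn_even_gt0 //= subr_ge0 ler_pdivlMr// mul1r /M.
by have := normr_ge0 d; lra.
Qed.

Section Maximizer.

Variables (k : R) (x : V -> R).
Hypotheses (r_gt0 : (0 < r)%N) (Er : uniform r E) (k_gt0 : 0 < k).
Hypotheses (x_ge0 : forall v, 0 <= x v) (x_ge1 : 1 <= power_sum x).
Hypothesis eq_x : edge_form x = k * power_sum x.
Hypothesis le_y : forall y, (forall v, 0 <= y v) -> edge_form y <= k * power_sum y.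

(** Only the entry at [v] varies, by a factor [1 + s]. The edge form is affine in it and gains
    [A * s], so maximality puts a line below a power curve. A factor keeps the entry nonnegative and
    includes the case [x v = 0]. *)
Lemma maximizer_eigen v :
  \sum_(e in E | v \in e) \prod_(u in e) x u = r%:R * k * x v ^+ r.
Proof.
set A := \sum_(e in E | _) _.
suff -> : A = k * x v ^+ r * r%:R by rewrite mulrC mulrA.
apply: tangent_slope => [|s]; first by rewrite mulr_ge0 ?exprn_ge0 // ltW.
rewrite ler_norml => /andP[s_ge s_le].
pose y w := if w == v then (1 + s) * x w else x w.
have y0 w : 0 <= y w by rewrite /y; case: ifP => // _; rewrite mulr_ge0//; lra.
have := le_y y0.
have -> : edge_form y = edge_form x + A * s.
  rewrite /edge_form (bigID (fun e : {set V} => v \in e)).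
  rewrite [X in _ = X + _](bigID (fun e : {set V} => v \in e)) /=.
  rewrite -/A -addrA [RHS]addrCA addrC; congr (_ + _).
    apply: eq_bigr => e /andP[_ ve]; apply: eq_bigr => w we.
    by rewrite /y; case: eqP => // eq_wv; rewrite -eq_wv we in ve.
  rewrite mulr_suml -big_split /=; apply: eq_bigr => e /andP[_ ve].
  rewrite (bigD1 v) //= [\prod_(u in e) x u](bigD1 v) //= /y eqxx.
  rewrite (eq_bigr x) => [|w /andP[_ /negPf ->]//].
  by ring.
have -> : power_sum y = power_sum x + x v ^+ r * ((1 + s) ^+ r - 1).
  rewrite /power_sum (bigD1 v) //= [X in _ = X + _](bigD1 v) //= /y eqxx.
  rewrite (eq_bigr (fun w => x w ^+ r)) => [|w /negPf ->//].
  by rewrite exprMn; ring.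
rewrite eq_x; lra.
Qed.

(** If all zero entries are raised to [t], the edge [e] gains at least [c * t ^+ r.-1], since [u]
    leaves it at most [r.-1] zero entries, whereas the power sum grows only by [N * t ^+ r]. For
    small [t] this contradicts maximality. *)
Lemma maximizer_edge_gt0 e u w : e \in E -> u \in e -> w \in e -> 0 < x u -> 0 < x w.
Proof.
move=> eE ue we xu; rewrite lt_neqAle x_ge0 andbT eq_sym.
apply/negP => /eqP xw0.
pose c := \prod_(z in e | x z != 0) x z.
have c_gt0 : 0 < c.
  by apply: prodr_gt0 => z /andP[_ xz]; rewrite lt_neqAle eq_sym xz x_ge0.
pose N : R := #|[pred z | x z == 0]|%:R.
have kN0 : 0 <= k * N by rewrite mulr_ge0 // ltW.
(* This choice gives both [t <= 1] and [k * N * t < c]. *)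
pose t := c / (c + k * N).
have t_gt0 : 0 < t by rewrite divr_gt0 // ltr_wpDr.
have t_le1 : t <= 1 by rewrite ler_pdivrMr ?ltr_wpDr// mul1r lerDl.
pose y z := if x z == 0 then t else x z.
have y0 z : 0 <= y z by rewrite /y; case: ifP => // _; exact: ltW.
have le_xy z : x z <= y z by rewrite /y; case: eqP => // ->; exact: ltW.
have ps_y : power_sum y = power_sum x + N * t ^+ r.
  rewrite /power_sum (bigID (fun z => x z == 0)).
  rewrite [X in _ = X + _](bigID (fun z => x z == 0)) /=.
  rewrite [X in _ = X + _ + _]big1 => [|z /eqP ->]; last by rewrite expr0n gtn_eqF.
  rewrite add0r addrC; congr (_ + _).
    by apply: eq_bigr => z /negPf xz; rewrite /y xz.
  rewrite (eq_bigr (fun=> t ^+ r)) => [|z xz]; last by rewrite /y xz.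
  by rewrite sumr_const -mulr_natl.
have form_y : edge_form x + c * t ^+ r.-1 <= edge_form y.
  rewrite /edge_form (bigD1 e) // [leRHS](bigD1 e) //= (bigD1 w) //= xw0 mul0r add0r.
  rewrite [leLHS]addrC; apply: lerD.
    rewrite [leRHS](bigID (fun z => x z == 0)) /= mulrC; apply: ler_pM.
    - by rewrite exprn_ge0 // ltW.
    - exact: ltW.
    - rewrite (eq_bigr (fun=> t)) => [|z /andP[_ xz]]; last by rewrite /y xz.
      rewrite prodr_const; apply: ler_wiXn2l; rewrite ?(ltW t_gt0)//.
      rewrite -ltnS prednK// -(Er eE); apply: proper_card; apply/properP; split.
        by apply/subsetP => z /andP[].
      by exists u => //; apply/negP => /andP[_]; rewrite gt_eqF.
    rewrite le_eqVlt; apply/orP; left; apply/eqP/eq_bigr => z /andP[_ /negPf xz].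
    by rewrite /y xz.
  by apply: ler_sum => f _; apply: ler_prod => z _; rewrite x_ge0 le_xy.
have := le_trans form_y (le_y y0); rewrite ps_y eq_x mulrDr lerD2l.
rewrite -{2}(prednK r_gt0) exprS !mulrA ler_pM2r ?exprn_gt0//.
rewrite ler_pdivlMr ?ltr_wpDr// mulrDr -subr_ge0.
have -> : k * N * c - (c * c + c * (k * N)) = - (c * c) by ring.
by rewrite oppr_ge0 leNgt mulr_gt0.
Qed.

Lemma maximizer_gt0 : connected_hypergraph E -> forall v, 0 < x v.
Proof.
move=> cE v; have [u xu] : exists u, 0 < x u.
  apply/existsP; apply: contraTT x_ge1; rewrite negb_exists => /forallP x0.
  rewrite /power_sum big1 ?ler10 // => u _; have := x0 u; rewrite -leNgt => xu0.
  have -> : x u = 0 by apply/eqP; rewrite eq_le xu0 x_ge0.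
  by rewrite expr0n gtn_eqF.
elim/connect_invariant: v / (cE u v) => // v w xv /adjacentP[e [eE ve we]].
exact: maximizer_edge_gt0 ve we xv.
Qed.

End Maximizer.

End EdgeForm.

(** * From the adjacency tensor to the edge form *)

Local Open Scope complex_scope.

Lemma sum_incidence (R : nmodType) (V : finType) (E : {set {set V}})
    (F : V -> {set V} -> R) :
  \sum_v \sum_(e in E | v \in e) F v e = \sum_(e in E) \sum_(v in e) F v e.
Proof.
rewrite (exchange_big_dep (mem E)) /= => [|v e _ /andP[]//].
by apply: eq_bigr => e eE; apply: eq_bigl => v; rewrite eE.
Qed.

Section Tensor.

Variables (R : realType) (V : finType) (E : {set {set V}}) (k : nat).
Hypothesis Er : uniform k.+1 E.

Lemma tuple_coverE (e : {set V}) (v : V) (t : k.-tuple V) : #|e| = k.+1 -> v \in e ->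
  ([set w in [tuple of v :: t]] == e) = all (mem (e :\ v)) t && uniq t.
Proof.
move=> cE ve; apply/eqP/andP => [eq_e|[/allP te Ut]].
  have /card_uniqP/andP[vt Ut] : #|v :: t| = size (v :: t).
    by rewrite -cardsE /= size_tuple -cE -eq_e; apply: eq_card => w; rewrite !inE.
  split=> //; apply/allP => w wt; rewrite /= !inE -eq_e !inE wt orbT andbT.
  by apply: contraNneq vt => <-.
apply/eqP; rewrite eqEcard; apply/andP; split.
  apply/subsetP => w; rewrite !inE => /orP[/eqP -> //|/te].
  by rewrite !inE => /andP[].
rewrite cE cardsE /=; have /card_uniqP -> : uniq (v :: t).
  by rewrite /= Ut andbT; apply/negP => /te; rewrite !inE eqxx.
by rewrite /= size_tuple.
Qed.

(** For each edge [e] at [v], the nonzero entries come from the [k!] orderings of [e :\ v], which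
    cancel the denominator. *)
Lemma tensor_apply_adjacency (z : V -> R[i]) v :
  tensor_apply (@adjacency_tensor R V k E) z v
    = \sum_(e in E | v \in e) \prod_(u in e :\ v) z u.
Proof.
rewrite /tensor_apply /adjacency_tensor.
pose s (t : k.-tuple V) := [set w in [tuple of v :: t]].
rewrite (bigID (fun t => s t \in E)) /= addrC big1 ?add0r => [|t /negPf tE]; last first.
  by rewrite tE mul0r.
rewrite (partition_big s (fun e => (e \in E) && (v \in e))) /=; last first.
  by move=> t ->; rewrite !inE eqxx.
apply: eq_bigr => e /andP[eE ve].
rewrite (eq_bigr (fun=> (k`!%:R)^-1 * \prod_(u in e :\ v) z u)).
  rewrite sumr_const.
  rewrite (_ : #|_| = k`!) ?mulrnAl.
    by rewrite -mulrnAl -mulr_natr mulVf ?mul1r // pnatr_eq0 -lt0n fact_gt0.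
  have card_ev : #|e :\ v| = k by have := cardsD1 v e; rewrite ve Er // => -[].
  rewrite -[RHS]ffactnn -[X in X ^_ _]card_ev -card_uniq_tuples.
  apply: eq_card => t; rewrite !inE -[LHS]/((s t \in E) && (s t == e)).
  rewrite -tuple_coverE ?Er // andbC; apply: andb_idr => /eqP st.
  by rewrite -/(s t) st.
move=> t /andP[tE /eqP st]; rewrite -/(s t) tE; congr (_ * _).
have /andP[te Ut] : all (mem (e :\ v)) t && uniq t.
  by rewrite -tuple_coverE ?Er // -st.
rewrite -(big_tuple _ _ t xpredT z) big_uniq //; apply: eq_bigl => w.
apply/idP/idP => [wt|]; first by have /allP := te; apply.
rewrite !inE => /andP[neq_wv]; rewrite -st !inE (negPf neq_wv).
by [].
Qed.

(** By the triangle inequality, the moduli [y] of an eigenvector satisfy the inequalities [le_v].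
    Summed over all vertices, these count each edge [k.+1] times. *)
Lemma eigenvalue_le (l : R[i]) (k0 : R) :
  (forall y : V -> R, (forall v, 0 <= y v) -> edge_form E y <= k0 * power_sum k.+1 y) ->
  tensor_eigenvalue (@adjacency_tensor R V k E) l -> complex.Re `|l| <= k.+1%:R * k0.
Proof.
move=> le_y [z [[v0 zv0] eig]].
have normE (c : R[i]) : `|c| = (complex.Re `|c|)%:C by rewrite RRe_real // normr_real.
have Re_ge0 (c : R[i]) : 0 <= complex.Re `|c| by rewrite -lecR -normE normr_ge0.
pose y v := complex.Re `|z v|.
have zy v : `|z v| = (y v)%:C := normE _.
have y0 v : 0 <= y v := Re_ge0 _.
have le_v v : complex.Re `|l| * y v ^+ k.+1
    <= \sum_(e in E | v \in e) \prod_(u in e) y u.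
  rewrite -lecR rmorphM rmorphXn /= -normE -zy exprSr mulrA -normrX -normrM -eig.
  rewrite tensor_apply_adjacency -normrM mulr_suml rmorph_sum.
  apply: le_trans (ler_norm_sum _ _ _) _.
  apply: ler_sum => e /andP[_ ve]; rewrite [leRHS]rmorph_prod /= [leRHS](big_setD1 v) //= mulrC.
  by rewrite normrM zy normr_prod; rewrite le_eqVlt; apply/orP; left; apply/eqP;
    congr (_ * _); apply: eq_bigr => u _; rewrite zy.
have ps_gt0 : 0 < power_sum k.+1 y.
  rewrite /power_sum (bigD1 v0) //= ltr_wpDr ?exprn_gt0 ?sumr_ge0 //.
    by move=> w _; rewrite exprn_ge0.
  rewrite lt_neqAle y0 andbT eq_sym; apply: contraNneq zv0 => yv0.
  by rewrite -normr_eq0 zy yv0.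
rewrite -(ler_pM2r ps_gt0) -mulrA.
apply: le_trans (_ : k.+1%:R * edge_form E y <= _); last first.
  by rewrite ler_wpM2l // le_y.
rewrite /power_sum mulr_sumr; apply: le_trans (ler_sum _ (fun v _ => le_v v)) _.
rewrite sum_incidence /edge_form mulr_sumr; apply: ler_sum => e eE.
by rewrite sumr_const Er // mulr_natl.
Qed.

End Tensor.

(** The maximal ratio times [r] is an eigenvalue, with the maximizer as eigenvector, and bounds the
    moduli of all eigenvalues; so the supremum is attained there. *)
Lemma spectral_perron (R : realType) (r : nat) (V : finType) (E : {set {set V}}) :
    (0 < r)%N -> uniform r E -> connected_hypergraph E -> E != set0 ->
  exists2 x : V -> R, (forall v, 0 < x v) & 0 < spectral_radius R r E /\
    forall v, \sum_(e in E | v \in e) \prod_(u in e) x u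
      = spectral_radius R r E * x v ^+ r.
Proof.
case: r => // k _ Er cE E0.
have [k0 [x [k0_gt0 x_ge0 x_ge1 eq_x le_y]]] := ratio_max R (ltn0Sn k) Er E0.
have x_gt0 := maximizer_gt0 (ltn0Sn k) Er k0_gt0 x_ge0 x_ge1 eq_x le_y cE.
have eig := maximizer_eigen k0_gt0 x_ge0 eq_x le_y.
suff -> : spectral_radius R k.+1 E = k.+1%:R * k0.
  by exists x => //; split => //; rewrite mulr_gt0 // ltr0n.
have rho_ge0 : 0 <= k.+1%:R * k0 by rewrite mulr_ge0 ?ltW.
set S := [set complex.Re `|l| | l in tensor_eigenvalue (@adjacency_tensor R V k E)]%classic.
have ubS : ubound S (k.+1%:R * k0).
  by move=> _ [l /= hl <-]; exact: eigenvalue_le le_y hl.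
have inS : S (k.+1%:R * k0).
  exists (k.+1%:R * k0)%:C; last by rewrite ger0_norm // lecR.
  have /set0Pn[e0 e0E] := E0.
  have /card_gt0P[v0 _] : (0 < #|e0|)%N by rewrite Er.
  exists (fun v => (x v)%:C); split.
    by exists v0; rewrite fmorph_eq0 gt_eqF.
  move=> v; rewrite tensor_apply_adjacency // -rmorphXn -rmorphM /=.
  have -> : k.+1%:R * k0 * x v ^+ k = (k.+1%:R * k0 * x v ^+ k.+1) / x v.
    by rewrite exprSr mulrA mulfK // gt_eqF.
  rewrite -eig mulr_suml rmorph_sum; apply: eq_bigr => e /andP[_ ve].
  rewrite [in RHS](big_setD1 v) //= mulrAC divff ?gt_eqF// mul1r.
  by rewrite rmorph_prod.
apply/eqP; rewrite eq_le; apply/andP; split.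
  by apply: ge_sup => //; exists (k.+1%:R * k0).
by apply: ub_le_sup => //; exists (k.+1%:R * k0).
Qed.

Local Close Scope complex_scope.

(** * Upper bounds on the spectral radius from labels *)

Section LabelBounds.

Variables (R : realType) (r : nat) (V : finType) (E : {set {set V}}).
Hypotheses (r_gt0 : (0 < r)%N) (Er : uniform r E).
Hypotheses (cE : connected_hypergraph E) (E_neq0 : E != set0).
Variables (l : R) (B : V -> {set V} -> R).
Hypotheses (l_gt0 : 0 < l) (B_ge0 : forall v e, 0 <= B v e).
Hypothesis B_prod : forall e, e \in E -> l ^- r <= \prod_(v in e) B v e.
Hypothesis B_sum : forall v, \sum_(e in E | v \in e) B v e <= 1.

Lemma edge_AGM (x : V -> R) e : (forall v, 0 < x v) -> e \in E ->
  r%:R * \prod_(v in e) x v <= l * \sum_(v in e) B v e * x v ^+ r.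
Proof.
move=> x_gt0 eE; set S := \sum_(v in e) _.
have x_ge0 v : 0 <= x v ^+ r by rewrite exprn_ge0 // ltW.
have S_ge0 : 0 <= S by apply: sumr_ge0 => v _; rewrite mulr_ge0.
have r0 : 0 < r%:R :> R by rewrite ltr0n.
rewrite mulrC -ler_pdivlMr // -mulrA.
rewrite -(ler_pXn2r r_gt0) ?nnegrE; last 2 first.
- by apply: prodr_ge0 => v _; exact: ltW.
- by rewrite !mulr_ge0 ?invr_ge0 // ltW.
rewrite exprMn mulrC -ler_pdivrMr ?exprn_gt0 // -prodrXl.
have := leif_AGM (A := mem e) (E := fun v => B v e * x v ^+ r).
rewrite Er // => /(_ (fun v _ => mulr_ge0 (B_ge0 v e) (x_ge0 v)))[le_AGM _].
apply: le_trans le_AGM; rewrite big_split /= mulrC ler_wpM2r //; last exact: B_prod.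
exact: prodr_ge0.
Qed.

Let sum_labels (x : V -> R) : (forall v, 0 < x v) ->
  (forall v, \sum_(e in E | v \in e) \prod_(u in e) x u
     = spectral_radius R r E * x v ^+ r) ->
  spectral_radius R r E * power_sum r x
    <= l * \sum_v (\sum_(e in E | v \in e) B v e) * x v ^+ r.
Proof.
move=> x_gt0 eig; rewrite /power_sum mulr_sumr -(eq_bigr _ (fun v _ => eig v)).
rewrite sum_incidence; under [X in l * X]eq_bigr do rewrite mulr_suml.
rewrite sum_incidence mulr_sumr; apply: ler_sum => e eE.
by rewrite sumr_const Er // -mulr_natl; exact: edge_AGM.
Qed.

Lemma label_bound : spectral_radius R r E <= l.
Proof.
have [x x_gt0 [rho_gt0 eig]] := spectral_perron R r_gt0 Er cE E_neq0.
have ps_gt0 : 0 < power_sum r x.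
  have /set0Pn[e eE] := E_neq0.
  have /card_gt0P[v _] : (0 < #|e|)%N by rewrite Er.
  rewrite /power_sum (bigD1 v) //= ltr_wpDr ?exprn_gt0 // sumr_ge0 // => w _.
  by rewrite exprn_ge0 // ltW.
rewrite -(ler_pM2r ps_gt0); apply: le_trans (sum_labels x_gt0 eig) _.
rewrite ler_pM2l //; apply: ler_sum => v _.
by rewrite ler_piMl // exprn_ge0 // ltW.
Qed.

Lemma label_bound_lt v : \sum_(e in E | v \in e) B v e < 1 -> spectral_radius R r E < l.
Proof.
move=> lt1; have [x x_gt0 [rho_gt0 eig]] := spectral_perron R r_gt0 Er cE E_neq0.
have ps_gt0 : 0 < power_sum r x.
  rewrite /power_sum (bigD1 v) //= ltr_wpDr ?exprn_gt0 // sumr_ge0 // => w _.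
  by rewrite exprn_ge0 // ltW.
rewrite -(ltr_pM2r ps_gt0); apply: le_lt_trans (sum_labels x_gt0 eig) _.
rewrite ltr_pM2l // /power_sum (bigD1 v) //= [ltRHS](bigD1 v) //=.
apply: ltr_leD; first by rewrite gtr_pMl ?exprn_gt0.
by apply: ler_sum => w _; rewrite ler_piMl // exprn_ge0 // ltW.
Qed.

End LabelBounds.

(** * Branched supertrees *)

Definition branching_vertex (V : finType) (E : {set {set V}}) (v : V) :=
  exists e1 e2 e3, uniq [:: e1; e2; e3] /\
    forall e, e \in [:: e1; e2; e3] -> (e \in E) && (v \in e).

Definition branching_edge (V : finType) (E : {set {set V}}) (e : {set V}) :=
  e \in E /\ exists u1 u2 u3, [/\ uniq [:: u1; u2; u3],
    forall u, u \in [:: u1; u2; u3] -> u \in e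
    & forall u, u \in [:: u1; u2; u3] -> exists2 f, f \in E :\ e & u \in f].

Lemma branched_gap (R : realType) (r : nat) (V : finType) (E : {set {set V}}) :
    (0 < r)%N -> supertree r E -> (3 < #|E|)%N ->
    (exists v, branching_vertex E v) \/ (exists e, branching_edge E e) ->
  let al := spectral_radius R r E ^- r in
  [/\ 0 < spectral_radius R r E, 0 < al & al <= gap al 1 ^+ 2 * gap al (#|E| - 3)].
Proof.
move=> r_gt0 [Er _ cE acE] lt3E hbr al.
have E_neq0 : E != set0 by rewrite -card_gt0 (leq_trans _ lt3E).
have [x x_gt0 [rho_gt0 eig]] := spectral_perron R r_gt0 Er cE E_neq0.
have al_gt0 : 0 < al by rewrite invr_gt0 exprn_gt0.
split=> //; set rho := spectral_radius R r E in rho_gt0 al al_gt0 eig *.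
pose B v (e : {set V}) := (\prod_(u in e) x u) / (rho * x v ^+ r).
have den_gt0 v : 0 < rho * x v ^+ r by rewrite mulr_gt0 ?exprn_gt0.
have B_sum v : \sum_(e in E | v \in e) B v e = 1.
  by rewrite -mulr_suml eig divff // gt_eqF.
have labels v : subnormal_labels al B E v.
  split=> [u e|e eE|u _]; last by rewrite B_sum.
    by rewrite divr_ge0 ?prodr_ge0 // => *; exact: ltW.
  rewrite /B big_split /= prodr_const Er // prodfV big_split /= prodr_const Er //.
  rewrite prodrXl invfM mulrCA mulfV ?mulr1 // gt_eqF // exprn_gt0 //.
  by apply: prodr_gt0.
have cc v : component E v = E.
  by apply: component_connected => // e eE; rewrite -card_gt0 Er.
have B_le1 v : \sum_(e in E | v \in e) B v e <= 1 by rewrite B_sum.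
case: hbr => [[v [e1 [e2 [e3 [Ue he]]]]]|[e [eE [u1 [u2 [u3 [Uu hu hf]]]]]]].
  exact: (gap3_of_vertex al_gt0 acE cc labels B_le1 lt3E Ue he).
apply: (gap3_of_edge al_gt0 acE cc labels B_le1 eE _ _ _ Uu hf);
  by apply: hu; rewrite !inE eqxx ?orbT.
Qed.

(** * Supertrees enumerated edge by edge *)

Section Enumeration.

Local Open Scope nat_scope.

(* The edges [g 0, ..., g (m - 1)] are listed so that each of them meets the
   union of the previous ones in exactly one vertex. *)
Definition tree_enum (V : finType) (r m : nat) (g : nat -> {set V}) :=
  [/\ forall j, j < m -> #|g j| = r,
      forall i i' j x y, i < j < m -> i' < j -> x \in g j -> y \in g j ->
        x \in g i -> y \in g i' -> x = y,
      forall j, 0 < j < m -> exists2 x, x \in g j & exists2 i, i < j & x \in g i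
    & forall v, exists2 i, i < m & v \in g i].

Variables (V : finType) (r m : nat) (g : nat -> {set V}).
Hypotheses (r_gt1 : 1 < r) (g_enum : tree_enum r m g).

Let E : {set {set V}} := [set g i | i : 'I_m].

Lemma tree_enum_inj : injective (fun i : 'I_m => g i).
Proof.
have [gr g_meet _ _] := g_enum.
suff lt_neq (i j : 'I_m) : i < j -> g i <> g j.
  by move=> i j /= eq_g; case: (ltngtP i j) => [/lt_neq []|/lt_neq []|/val_inj].
move=> lt_ij eq_g; have /card_gt1P[x [y [xj yj]]] : 1 < #|g j| by rewrite gr.
case/eqP; apply: (g_meet i i j) => //; rewrite ?eq_g //.
by rewrite lt_ij ltn_ord.
Qed.

Lemma tree_enum_supertree : supertree r E /\ #|E| = m.
Proof.
have [gr g_meet g_conn g_cov] := g_enum.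
split; last by rewrite card_imset ?card_ord //; exact: tree_enum_inj.
split.
- by move=> _ /imsetP[i _ ->]; apply: gr.
- have lin (i j : 'I_m) : i < j -> #|g i :&: g j| <= 1.
    move=> lt_ij; apply/card_le1_eqP => x y /setIP[xi xj] /setIP[yi yj].
    by apply: (g_meet i i j); rewrite // lt_ij ltn_ord.
  move=> _ _ /imsetP[i _ ->] /imsetP[j _ ->].
  case: (ltngtP i j) => [/lin //|/lin|/val_inj ->]; first by rewrite setIC.
  by rewrite eqxx.
- have gE i : i < m -> g i \in E.
    by move=> lt_im; apply/imsetP; exists (Ordinal lt_im).
  have conn j : forall x b, j < m -> x \in g j -> b \in g 0 -> connect (adjacent E) b x.
    have [n] := ubnP j; elim: n j => // n IHn [|j] lt_jn x b lt_jm xj b0.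
      by apply/connect1/adjacentP; exists (g 0); split=> //; exact: gE.
    have [z zj [i lt_ij zi]] := g_conn j.+1 lt_jm.
    apply: (connect_trans (y := z)).
      by apply: (IHn i) => //; [exact: leq_trans lt_ij lt_jn | exact: ltn_trans lt_ij lt_jm].
    by apply/connect1/adjacentP; exists (g j.+1); split=> //; exact: gE.
  move=> u v; have [i lt_im ui] := g_cov u; have [j lt_jm vj] := g_cov v.
  have /card_gt0P[b b0] : 0 < #|g 0| by rewrite gr ?(ltnW r_gt1) // (leq_ltn_trans _ lt_im).
  apply: (connect_trans (y := b)); last exact: conn vj b0.
  by rewrite connect_adjacent_sym; exact: conn ui b0.
move=> n v e [n_gt1 vI eI eE ve].
have /fin_all_exists[f ef] i : exists j : 'I_m, e i = g j.
  by have /imsetP[j _ ->] := eE i; exists j.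
pose i0 : 'I_n := Ordinal (ltnW n_gt1).
(* In a cycle, the edge of largest index has both of its cycle vertices in earlier edges, so they
   coincide. *)
case: (@arg_maxnP _ i0 xpredT (fun i => f i) isT) => i _ imax.
have neqS (j : 'I_n) : ordS j != j.
  apply/negP => /eqP/(congr1 val) /=; have := ltn_ord j; rewrite leq_eqVlt.
  case/orP=> [/eqP eq_n|lt_jn]; last by rewrite modn_small //; lia.
  by rewrite eq_n modnn; lia.
have ltf j : j != i -> f j < f i.
  move=> neq_ji; have le_ji : f j <= f i := imax j isT.
  rewrite ltn_neqAle le_ji andbT.
  by apply: contra neq_ji => /eqP/val_inj eq_f; apply/eqP/eI; rewrite !ef eq_f.
have := neqS i; case/eqP; apply: vI; apply/esym.
have [vi vSi] := ve i; have [vSi' _] := ve (ordS i); have [_ vi'] := ve (ord_pred i).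
rewrite ord_predK in vi'; rewrite !ef in vi vSi vSi' vi'.
apply: (g_meet (f (ord_pred i)) (f (ordS i)) (f i)) => //; last exact/ltf/neqS.
rewrite ltn_ord andbT ltf //; apply: contraNneq (neqS (ord_pred i)) => eq_i.
by rewrite ord_predK eq_i.
Qed.

End Enumeration.

(** * The loose path and D as enumerated trees *)

Section LoosePath.

Local Open Scope nat_scope.

Variables (r m : nat).
Hypothesis r_gt2 : 2 < r.

Definition path_edge (i : nat) : {set 'I_(m * r.-1).+1} :=
  [set j : 'I_(m * r.-1).+1 | i * r.-1 <= j <= i.+1 * r.-1].

Lemma loose_pathE : loose_path r m = [set path_edge i | i : 'I_m].
Proof. by []. Qed.

Lemma path_edge_le i j : i < m -> j <= i.+1 * r.-1 -> j < (m * r.-1).+1.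
Proof. by move=> lt_im lej; rewrite ltnS (leq_trans lej) // leq_mul2r lt_im orbT. Qed.

Lemma card_path_edge i : i < m -> #|path_edge i| = r.
Proof.
move=> lt_im; have val_shift (t : 'I_r) :
    (inord (i * r.-1 + t) : 'I_(m * r.-1).+1) = i * r.-1 + t :> nat.
  rewrite inordK //; apply: (path_edge_le lt_im).
  by have := ltn_ord t; rewrite mulSn; lia.
have -> : path_edge i = [set inord (i * r.-1 + t) | t : 'I_r].
  apply/setP => x; rewrite inE; apply/andP/imsetP => [[le_x x_le]|[t _ ->]].
    have lt_r : x - i * r.-1 < r by move: x_le; rewrite mulSn; lia.
    exists (Ordinal lt_r) => //; apply: val_inj => /=.
    by rewrite (val_shift (Ordinal lt_r)) /= subnKC.
  by rewrite val_shift leq_addr mulSn; have := ltn_ord t; lia.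
rewrite card_imset ?card_ord // => t t' /(congr1 val) /=.
by rewrite !val_shift => /addnI/val_inj.
Qed.

Lemma path_edge_meet i j x : i < j -> x \in path_edge i -> x \in path_edge j ->
  x = j * r.-1 :> nat.
Proof.
move=> lt_ij; rewrite !inE => /andP[_ xi] /andP[xj _].
by apply/eqP; rewrite eqn_leq xj (leq_trans xi) // leq_mul2r lt_ij orbT.
Qed.

Lemma loose_path_enum : 0 < m -> tree_enum r m path_edge.
Proof.
move=> m_gt0; split.
- exact: card_path_edge.
- move=> i i' j x y /andP[lt_ij _] lt_i'j xj yj xi yi'; apply: val_inj => /=.
  by rewrite (path_edge_meet lt_ij xi xj) (path_edge_meet lt_i'j yi' yj).
- move=> j /andP[j_gt0 lt_jm].
  have val_j : (inord (j * r.-1) : 'I_(m * r.-1).+1) = j * r.-1 :> nat.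
    by rewrite inordK // ltnS leq_mul2r ltnW ?orbT.
  exists (inord (j * r.-1)); first by rewrite inE val_j leqnn leq_mul2r leqnSn orbT.
  exists j.-1; first by rewrite prednK.
  by rewrite inE val_j prednK // leqnn leq_mul2r leq_pred orbT.
move=> v; have r1_gt0 : 0 < r.-1 by lia.
have := ltn_ord v; rewrite ltnS leq_eqVlt => /orP[/eqP eq_v|lt_v].
  exists m.-1; first by rewrite prednK.
  by rewrite inE eq_v prednK // leqnn leq_mul2r leq_pred orbT.
exists (v %/ r.-1); first by rewrite ltn_divLR.
by rewrite inE leq_trunc_div /= ltnW // ltn_ceil.
Qed.

Lemma loose_path_supertree : 0 < m ->
  supertree r (loose_path r m) /\ #|loose_path r m| = m.
Proof.
move=> m_gt0; rewrite loose_pathE; apply: tree_enum_supertree; first exact: ltnW.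
exact: loose_path_enum.
Qed.

End LoosePath.

Section Attach.

Local Open Scope nat_scope.

Variables (V : finType) (r m : nat) (g : nat -> {set V}) (u : V).
Hypotheses (r_gt1 : 1 < r) (g_enum : tree_enum r m g).

(** The pendent edge comes last, at index [m], where it meets the earlier edges in [inl u] only. *)
Definition attach_enum (i : nat) : {set (V + 'I_r.-1)%type} :=
  if i < m then [set inl w | w in g i] else inl u |: [set inr j | j : 'I_r.-1].

Lemma attach_pendentE : attach_pendent r [set g i | i : 'I_m] u
  = [set attach_enum i | i : 'I_m.+1].
Proof.
apply/setP => e; rewrite !inE; apply/orP/imsetP => [[/eqP ->|/imsetP[f]]|[i _ ->]].
- by exists ord_max; rewrite // /attach_enum ltnn.
- case/imsetP=> i _ -> ->; exists (widen_ord (leqnSn m) i) => //.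
  by rewrite /attach_enum /= ltn_ord.
rewrite /attach_enum; case: ifP => lt_im; [right|by left].
by apply/imsetP; exists (g i) => //; apply/imsetP; exists (Ordinal lt_im).
Qed.

Lemma attach_enumP : tree_enum r m.+1 attach_enum.
Proof.
have [gr g_meet g_conn g_cov] := g_enum.
have in_inl i (x : V + 'I_r.-1) : i < m -> x \in attach_enum i ->
    exists2 w, x = inl w & w \in g i.
  by rewrite /attach_enum => -> /imsetP[w wi ->]; exists w.
have in_last x i : i < m -> x \in attach_enum m -> x \in attach_enum i -> x = inl u.
  move=> lt_im xm /(in_inl _ _ lt_im)[w eq_x _]; move: xm.
  by rewrite eq_x /attach_enum ltnn => /setU1P[|/imsetP[]].
have inl_in w i : i < m -> w \in g i -> inl w \in attach_enum i.
  by rewrite /attach_enum => -> wi; apply/imsetP; exists w.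
split.
- move=> j _; rewrite /attach_enum; case: ifP => [lt_jm|_].
    by rewrite card_imset ?gr //; exact: inl_inj.
  rewrite cardsU1 card_imset ?card_ord; last exact: inr_inj.
  rewrite (_ : _ \notin _); first by rewrite add1n prednK // ltnW.
  by apply/negP => /imsetP[].
- move=> i i' j x y /andP[lt_ij]; rewrite ltnS leq_eqVlt => /orP[/eqP eq_jm|lt_jm] lt_i'j.
    rewrite eq_jm in lt_ij lt_i'j * => xm ym xi yi'.
    by rewrite (in_last _ _ lt_ij xm xi) (in_last _ _ lt_i'j ym yi').
  move=> /(in_inl _ _ lt_jm)[w -> wj] /(in_inl _ _ lt_jm)[w' -> w'j].
  move=> /(in_inl _ _ (ltn_trans lt_ij lt_jm))[_ [<-] wi].
  move=> /(in_inl _ _ (ltn_trans lt_i'j lt_jm))[_ [<-] w'i'].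
  by congr inl; apply: (g_meet i i' j); rewrite // lt_ij.
- move=> j /andP[j_gt0]; rewrite ltnS leq_eqVlt => /orP[/eqP eq_jm|lt_jm].
    exists (inl u); first by rewrite eq_jm /attach_enum ltnn setU11.
    by have [i lt_im ui] := g_cov u; exists i; [rewrite eq_jm | exact: inl_in].
  have [|x xj [i lt_ij xi]] := g_conn j; first by rewrite j_gt0.
  exists (inl x); first exact: inl_in.
  by exists i => //; apply: inl_in; rewrite // (ltn_trans lt_ij).
case=> [w|j].
  by have [i lt_im wi] := g_cov w; exists i; [exact: leqW | exact: inl_in].
by exists m => //; rewrite /attach_enum ltnn !inE; apply/imsetP; exists j.
Qed.

End Attach.

Lemma D_supertree_supertree (r m : nat) : (2 < r)%N -> (1 < m)%N ->
  supertree r (D_supertree r m) /\ #|D_supertree r m| = m.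
Proof.
case: m => // m r_gt2 m_gt0; rewrite /D_supertree /= loose_pathE attach_pendentE.
apply: tree_enum_supertree; first exact: ltnW.
by apply: attach_enumP; [exact: ltnW | exact: loose_path_enum].
Qed.

(** * Explicit labels on the path and on D *)

Section EnumeratedLabels.

Variables (R : realType) (r m : nat) (V : finType) (g : nat -> {set V}).
Hypotheses (r_gt1 : (1 < r)%N) (m_gt0 : (0 < m)%N) (g_enum : tree_enum r m g).
Variables (l : R) (B : V -> nat -> R).
Hypotheses (l_gt0 : 0 < l) (B_ge0 : forall v i, 0 <= B v i).
Hypothesis B_prod : forall i, (i < m)%N -> l ^- r <= \prod_(v in g i) B v i.
Hypothesis B_sum : forall v, \sum_(i < m | v \in g i) B v i <= 1.

Let E : {set {set V}} := [set g i | i : 'I_m].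
(** Labels indexed by position become labels indexed by edges; the sum has one term on each edge
    because the enumeration is injective. *)
Let B' v (e : {set V}) : R := \sum_(i < m | g i == e) B v i.

Let B'E v (i : 'I_m) : B' v (g i) = B v i.
Proof.
rewrite /B' (big_pred1 i) // => j; apply/eqP/eqP => [|-> //].
exact: (tree_enum_inj r_gt1 g_enum).
Qed.

Let sum_B' v : \sum_(e in E | v \in e) B' v e = \sum_(i < m | v \in g i) B v i.
Proof.
rewrite big_imset_cond => [|i j _ _]; last exact: (tree_enum_inj r_gt1 g_enum).
by apply: eq_big => [i|i _]; rewrite ?inE ?B'E.
Qed.

Let label_hyps : [/\ (0 < r)%N, uniform r E, connected_hypergraph E & E != set0] /\
  [/\ forall v e, 0 <= B' v e, forall e, e \in E -> l ^- r <= \prod_(v in e) B' v e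
    & forall v, \sum_(e in E | v \in e) B' v e <= 1].
Proof.
have [[Er _ cE _] cardE] := tree_enum_supertree r_gt1 g_enum.
split; first by split; rewrite // ?(ltnW r_gt1) // -card_gt0 cardE.
split=> [v e|_ /imsetP[i _ ->]|v]; first exact: sumr_ge0.
  by under eq_bigr do rewrite B'E; exact: B_prod.
by rewrite sum_B'.
Qed.

Lemma label_bound_enum : spectral_radius R r E <= l.
Proof.
have [[h1 h2 h3 h4] [h5 h6 h7]] := label_hyps.
exact: (label_bound h1 h2 h3 h4 l_gt0 h5 h6 h7).
Qed.

Lemma label_bound_enum_lt v : \sum_(i < m | v \in g i) B v i < 1 ->
  spectral_radius R r E < l.
Proof.
have [[h1 h2 h3 h4] [h5 h6 h7]] := label_hyps; rewrite -sum_B' => lt1.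
exact: (label_bound_lt h1 h2 h3 h4 l_gt0 h5 h6 h7 lt1).
Qed.

End EnumeratedLabels.

Section PathLabels.

Variables (R : realType) (r m : nat) (L M : nat -> R).
Hypothesis r_gt2 : (2 < r)%N.

Definition path_label (x : 'I_(m * r.-1).+1) (i : nat) : R :=
  if x == i * r.-1 :> nat then L i else if x == i.+1 * r.-1 :> nat then M i else 1.

Let r1_gt0 : (0 < r.-1)%N. Proof. by lia. Qed.

Lemma path_label_prod i : (i < m)%N ->
  \prod_(x in path_edge r m i) path_label x i = L i * M i.
Proof.
move=> lt_im.
have val_n n : (n <= m)%N -> (inord (n * r.-1) : 'I_(m * r.-1).+1) = (n * r.-1)%N :> nat.
  by move=> le_nm; rewrite inordK // ltnS leq_mul2r le_nm orbT.
have lt_S : (i * r.-1 < i.+1 * r.-1)%N by rewrite ltn_mul2r r1_gt0 ltnSn.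
rewrite (big_setD1 (inord (i * r.-1))) /=; last first.
  by rewrite inE val_n ?leqnn ?(ltnW lt_S) // ltnW.
rewrite (big_setD1 (inord (i.+1 * r.-1))) /=; last first.
  rewrite !inE val_n // leqnn (ltnW lt_S) !andbT -val_eqE /= !val_n //; last exact: ltnW.
  by rewrite gtn_eqF.
rewrite big1 ?mulr1 => [|x]; last first.
  rewrite !inE -!val_eqE /= !val_n // ?(ltnW lt_im) // /path_label.
  by case/andP=> /negPf -> /andP[/negPf -> _].
by rewrite /path_label !val_n ?(ltnW lt_im) // !eqxx gtn_eqF.
Qed.

Lemma mem_path_edge (x : 'I_(m * r.-1).+1) i :
  (x \in path_edge r m i)
    = (i == x %/ r.-1)%N || (r.-1 %| x)%N && (i.+1 == x %/ r.-1)%N.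
Proof.
rewrite inE -leq_divRL // [X in _ && X]leq_eqVlt.
have -> : (x < i.+1 * r.-1)%N = (x %/ r.-1 < i.+1)%N by rewrite ltn_divLR.
have -> : (x == i.+1 * r.-1 :> nat)%N = (r.-1 %| x)%N && (i.+1 == x %/ r.-1)%N.
  by apply/eqP/andP => [->|[d_x /eqP ->]]; rewrite ?dvdn_mull ?mulnK ?divnK.
case: (r.-1 %| x)%N => /=; lia.
Qed.

Lemma sum_path_edge (F : nat -> R) (x : 'I_(m * r.-1).+1) :
  let a := (x %/ r.-1)%N in
  \sum_(i < m | x \in path_edge r m i) F i =
    (if (a < m)%N then F a else 0) + (if (r.-1 %| x)%N && (0 < a)%N then F a.-1 else 0).
Proof.
move=> a; rewrite (bigID (fun i : 'I_m => i == a :> nat)) /=; congr (_ + _).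
  rewrite -(big_ord1_eq +%R); apply: eq_bigl => i; rewrite mem_path_edge -/a.
  by case: (i == a :> nat); rewrite ?andbF.
have le_am : (a <= m)%N.
  by rewrite -[leqRHS](mulnK m r1_gt0) leq_div2r // -ltnS ltn_ord.
case: ifP => [/andP[d_x a_gt0]|Na].
  have lt_am : (a.-1 < m)%N by rewrite prednK.
  have <- : (if (a.-1 < m)%N then F a.-1 else 0) = F a.-1 by rewrite lt_am.
  rewrite -(big_ord1_eq +%R).
  apply: eq_bigl => i; rewrite mem_path_edge -/a d_x /=; lia.
rewrite big_pred0 // => i; rewrite mem_path_edge -/a.
by apply/negP; move: Na; case: (r.-1 %| x)%N => /=; lia.
Qed.

Lemma path_label_sum x : L 0 <= 1 -> (forall i, (i.+1 < m)%N -> M i + L i.+1 <= 1) ->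
  M m.-1 <= 1 -> \sum_(i < m | x \in path_edge r m i) path_label x i <= 1.
Proof.
move=> L0 ML Mm; rewrite (sum_path_edge (path_label x)) /path_label.
have le_am : (x %/ r.-1 <= m)%N.
  by rewrite -[leqRHS](mulnK m r1_gt0) leq_div2r // -ltnS ltn_ord.
case: (boolP (r.-1 %| x)%N) => [d_x|Nd_x] /=; last first.
  have lt_am : (x %/ r.-1 < m)%N.
    rewrite ltn_divLR // ltn_neqAle -ltnS ltn_ord andbT.
    by apply: contraNneq Nd_x => ->; rewrite dvdn_mull.
  have neq n : (x == n * r.-1 :> nat)%N = false.
    by apply/negP => /eqP eq_x; rewrite eq_x dvdn_mull in Nd_x.
  by rewrite lt_am !neq addr0.
move: le_am; set a := (x %/ r.-1)%N => le_am.
have eq_x : x = (a * r.-1)%N :> nat by rewrite divnK.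
rewrite eq_x eqxx eqn_pmul2r //.
case: (posnP a) => [a0|a_gt0].
  by rewrite a0 addr0; case: ifP => // _; rewrite ler01.
rewrite (_ : (a == a.-1)%N = false) ?prednK ?eqxx //; last by apply/negP; lia.
case: ifP => [lt_am|/negbT]; first by rewrite addrC -{2}(prednK a_gt0) ML ?prednK.
by rewrite -leqNgt => le_ma; rewrite add0r (_ : a = m) //; apply/eqP; rewrite eqn_leq le_am.
Qed.

Lemma path_label_sum0 : (0 < m)%N ->
  \sum_(i < m | ord0 \in path_edge r m i) path_label ord0 i = L 0.
Proof.
by move=> m_gt0; rewrite (sum_path_edge (path_label ord0)) /= div0n m_gt0 andbF addr0.
Qed.

End PathLabels.

(** The label of edge [i] at its left end is what a path of [m - i] edges takes from its root, and
    at its right end what the remaining path leaves. Products are [al] and sums at the joints are 1;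
    the slack is at the first vertex, where [L 0] equals [al / gap al m.-1 < 1]. *)
Lemma spectral_radius_path_lt (R : realType) (r m : nat) (l : R) :
    (2 < r)%N -> (1 < m)%N -> 0 < l ->
    let al := l ^- r in al < gap al m.-1 ->
  spectral_radius R r (loose_path r m) < l.
Proof.
move=> r_gt2 m_gt1 l_gt0 al al_lt.
have m_gt0 : (0 < m)%N := ltnW m_gt1.
have al_gt0 : 0 < al by rewrite invr_gt0 exprn_gt0.
pose L i := 1 - gap al (m - i); pose M i := gap al (m - i.+1).
have L0 : L 0%N < 1.
  rewrite /L subn0 -{1}(prednK m_gt0) /= max_r ?(ltW al_lt)// opprB addrC subrK.
  by rewrite ltr_pdivrMr ?mul1r // (lt_trans al_gt0).
rewrite loose_pathE.
apply: (label_bound_enum_lt (B := @path_label R r m L M)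
         (ltnW r_gt2) m_gt0 (loose_path_enum r_gt2 m_gt0) l_gt0 _ _ _ (v := ord0)).
- move=> v i; rewrite /path_label; case: ifP => _; first by rewrite subr_ge0 gap_le1.
  by case: ifP => _; [exact: gap_ge0 | exact: ler01].
- move=> i lt_im; rewrite path_label_prod // /L /M -/al subnS.
  have : (0 < m - i)%N by rewrite subn_gt0.
  have : (m - i <= m)%N by rewrite leq_subr.
  case: (m - i)%N => // n le_nm _ /=; rewrite opprB addrC subrK.
  have al_n : al < gap al n by apply: lt_le_trans al_lt _; apply: gap_nonincreasing => //; lia.
  by rewrite max_r ?(ltW al_n) // divfK // gt_eqF // (lt_trans al_gt0).
- move=> v; apply: path_label_sum => //; first exact: ltW.
    by move=> i lt_im; rewrite /M /L addrC subrK.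
  by rewrite /M gap_le1.
by rewrite path_label_sum0.
Qed.

Local Arguments gap : simpl never.

Section DLabels.

Variables (r m : nat).
Hypotheses (r_gt2 : (2 < r)%N) (m_gt2 : (2 < m)%N).

Let u : 'I_(m * r.-1).+1 := inord r.

(** Here [m] counts the edges of the underlying path, one less than those of [D], so that
    [gap al m.-2] below is the gap of the size of [D] minus 3. *)
Let D : {set {set ('I_(m * r.-1).+1 + 'I_r.-1)%type}} := D_supertree r m.+1.

Let D_edge := attach_enum r m (path_edge r m) u.

Let DE : D = [set D_edge i | i : 'I_m.+1].
Proof. by rewrite /D /D_supertree loose_pathE attach_pendentE. Qed.

Let D_enum : tree_enum r m.+1 D_edge.
Proof. by apply: attach_enumP; [lia | apply: loose_path_enum => //; lia]. Qed.

Let val_u : u = r :> nat.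
Proof. by rewrite inordK // ltnS; nia. Qed.

Let r_div : (r %/ r.-1 = 1)%N.
Proof.
have {1}-> : (r = 1 * r.-1 + 1)%N by lia.
by rewrite divnMDl ?divn_small //; lia.
Qed.

Let Nr_dvd : (r.-1 %| r)%N = false.
Proof.
apply/negP; have {2}-> : (r = r.-1 + 1)%N by lia.
by rewrite dvdn_addr // dvdn1 => /eqP; lia.
Qed.

Let u_in_path i : (u \in path_edge r m i) = (i == 1)%N.
Proof. by rewrite mem_path_edge // val_u r_div Nr_dvd orbF. Qed.

Lemma D_branched : branching_edge D (D_edge 1).
Proof.
have inD i : (i < m.+1)%N -> (i != 1)%N -> D_edge i \in D :\ D_edge 1.
  move=> lt_im neq_i1; rewrite in_setD1 DE; apply/andP; split; last first.
    by apply/imsetP; exists (Ordinal lt_im).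
  have lt_1m : (1 < m.+1)%N by lia.
  apply: contra neq_i1 => /eqP.
  move/(@tree_enum_inj _ _ _ _ (ltnW r_gt2) D_enum (Ordinal lt_im) (Ordinal lt_1m)).
  by case=> ->.
have val_n n : (n <= m)%N -> (inord (n * r.-1) : 'I_(m * r.-1).+1) = (n * r.-1)%N :> nat.
  by move=> le_nm; rewrite inordK // ltnS leq_mul2r le_nm orbT.
have inl_in x i : (i < m)%N -> x \in path_edge r m i -> inl x \in D_edge i.
  by move=> lt_im xi; rewrite /D_edge /attach_enum lt_im; apply/imsetP; exists x.
have [lt_0m lt_1m] : (0 < m)%N /\ (1 < m)%N by lia.
split; first by rewrite DE; apply/imsetP; exists (Ordinal (leqW lt_1m)).
(* These are v_2, the attaching vertex and v_3, which also lie on the edges of index 0, [m] (the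
   pendent edge) and 2. *)
exists (inl (inord (1 * r.-1))), (inl u), (inl (inord (2 * r.-1))); split.
- rewrite /= !inE !negb_or !(inj_eq inl_inj) -!val_eqE /= !val_n ?val_u //.
  by apply/and3P; split=> //; [apply/andP; split|]; apply/eqP; lia.
- move=> v; rewrite !inE => /or3P[] /eqP ->; apply: inl_in => //.
  + by rewrite inE val_n //; lia.
  + by rewrite inE val_n //; lia.
move=> v; rewrite !inE => /or3P[] /eqP ->.
- exists (D_edge 0); first exact: inD.
  by apply: inl_in; rewrite // inE val_n // leqnn andbT.
- exists (D_edge m); first by apply: inD => //; lia.
  by rewrite /D_edge /attach_enum ltnn setU11.
exists (D_edge 2); first exact: inD.
by apply: inl_in; rewrite // inE val_n // leqnn; lia.
Qed.

Variables (R : realType) (l : R).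
Hypothesis l_gt0 : 0 < l.
Let al := l ^- r.
Hypothesis al_le : al <= gap al 1 ^+ 2 * gap al m.-2.

(** Edge 0 and the pendent edge each take [1 - gap al 1 = al] from edge 1 and have labels 1
    elsewhere; the tail leaves [gap al (m - 2)] at v_3. Edge 1 thus has product
    [gap al 1 ^+ 2 * gap al m.-2], and from edge 2 on the labels are those of the path. *)
Let L (i : nat) : R :=
  if i is k.+1 then if k is _.+1 then 1 - gap al (m - i) else gap al 1 else 1.
Let M (i : nat) : R := if i is _.+1 then gap al (m - i.+1) else 1 - gap al 1.

Let D_label (v : 'I_(m * r.-1).+1 + 'I_r.-1) (i : nat) : R :=
  if v is inl x then
    if (i < m)%N then if (x == u) && (i == 1%N) then gap al 1 else path_label L M x i
    else if x == u then 1 - gap al 1 else 1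
  else 1.

Lemma spectral_radius_D_le : spectral_radius R r D <= l.
Proof.
have al_gt0 : 0 < al by rewrite invr_gt0 exprn_gt0.
have al_lt : al < gap al m.-2.
  by move: al_le; rewrite expr2 -mulrA => h; apply: (gap_gt al_gt0 (a := 1)) => //;
    apply: le_trans h _; rewrite ler_piMl ?gap_le1 ?mulr_ge0 ?gap_ge0.
have al_lt1 : al < 1 := lt_le_trans al_lt (gap_le1 al_gt0 _).
have gap1 : 1 - gap al 1 = al by rewrite gapS max_r ?(ltW al_lt1)// divr1 opprB addrC subrK.
have L_ge0 i : 0 <= L i.
  by case: i => [|[|i]]; rewrite /L ?ler01 ?gap_ge0 // subr_ge0 gap_le1.
have M_ge0 i : 0 <= M i by case: i => [|i]; rewrite /M ?gap_ge0 // subr_ge0 gap_le1.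
have path_ge0 x i : 0 <= path_label L M x i :> R.
  by rewrite /path_label; do 2?[case: ifP => // _].
rewrite DE; apply: (label_bound_enum (B := D_label) (ltnW r_gt2) (ltn0Sn m) D_enum l_gt0).
- case=> [x|j] i /=; last exact: ler01.
  case: ifP => _; case: ifP => _; rewrite ?gap_ge0 ?ler01 //.
  by rewrite subr_ge0 gap_le1.
- move=> i; rewrite ltnS leq_eqVlt -/al => /orP[/eqP ->|lt_im].
    rewrite /D_edge {1}/attach_enum ltnn big_setU1 /=; last by apply/negP => /imsetP[].
    by rewrite ltnn eqxx gap1 big1 ?mulr1 // => _ /imsetP[j _ ->].
  rewrite /D_edge {1}/attach_enum lt_im big_imset /=; last by move=> ? ? _ _ [].
  rewrite lt_im; have := path_label_prod L M r_gt2 lt_im.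
  have [i1|neq_i1] := eqVneq i 1%N.
    rewrite i1 (big_setD1 u) ?u_in_path //= => [prodE].
    rewrite (big_setD1 u) ?u_in_path //= eqxx andbT.
    move: prodE; rewrite {1}/path_label val_u.
    rewrite (_ : (r == 1 * r.-1)%N = false); last by apply/negP => /eqP; lia.
    rewrite (_ : (r == 2 * r.-1)%N = false); last by apply/negP => /eqP; lia.
    rewrite mul1r => prodE; rewrite (eq_bigr (path_label L M ^~ 1%N)).
      by rewrite prodE /= mulrA -expr2 subn2.
    by move=> x /setD1P[/negPf ->].
  under [X in _ -> _ <= X]eq_bigr do rewrite andbF.
  move=> ->; case: i neq_i1 lt_im => [|[|i]] // _ lt_im; first by rewrite /L /M mul1r gap1.
  rewrite /L /M [(m - i.+3)%N]subnS; case def_n: (m - i.+2)%N => [|n]; first lia.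
  have al_n : al < gap al n by apply: lt_le_trans al_lt _; apply: gap_nonincreasing => //; lia.
  by rewrite gapS opprB addrC subrK max_r ?(ltW al_n) // divfK // gt_eqF // (lt_trans al_gt0).
case=> [x|j]; last first.
  rewrite (big_pred1 ord_max) /= // => i; rewrite /D_edge /attach_enum.
  case: ifP => lt_im.
    by apply/imsetP/eqP => [[]//|eq_i]; rewrite eq_i ltnn in lt_im.
  rewrite !inE imset_f ?orbT //; apply/esym/eqP/val_inj => /=.
  by have := ltn_ord i; lia.
rewrite big_mkcond big_ord_recr /= ltnn.
rewrite (_ : (inl x \in D_edge m) = (x == u)); last first.
  rewrite /D_edge /attach_enum ltnn !inE (inj_eq inl_inj); apply: orb_idr => /imsetP[]//.
have inE_path (i : 'I_m) : (inl x \in D_edge i) = (x \in path_edge r m i).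
  rewrite /D_edge /attach_enum ltn_ord mem_imset //; exact: inl_inj.
under eq_bigr => i _ do rewrite inE_path ltn_ord.
have [eq_x|neq_xu] := eqVneq x u.
  rewrite (bigD1 (Ordinal (ltnW m_gt2))) //= big1 => [|i].
    by rewrite eq_x u_in_path /= addr0 subrKC lexx.
  rewrite -val_eqE /= => /negPf neq_i1.
  by rewrite eq_x u_in_path neq_i1.
rewrite addr0 -big_mkcond; apply: path_label_sum => //.
  by case=> [|i] _; rewrite /L /M ?subrK ?subrKC.
by rewrite /M; case: (m.-1) => *; rewrite ?gap_le1 // lerBlDr lerDl gap_ge0.
Qed.

End DLabels.

(** * Unbranched supertrees are loose paths *)

Section Chains.

Local Open Scope nat_scope.

Variables (V : finType) (k : nat).
Implicit Types (E : {set {set V}}) (e f : {set V}) (u v w : V) (s : seq V).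

(** Edges of a loose path read off a list of its vertices: windows of [k.+1] entries starting at
    multiples of [k], so that neighbours share one entry. *)
Definition chunk s (i : nat) : {set V} := [set x in take k.+1 (drop (i * k) s)].

(** The root [v] is an end of the path to be built. It counts as a non-core vertex of its edge,
    which can then continue at one further vertex only; this vertex is the next root, and the
    removed edge accounts for its extra count. *)
Definition unbranched_from E v :=
  [/\ forall w, ~ branching_vertex E w,
      forall e f, e \in E -> f \in E -> v \in e -> v \in f -> e = f
    & forall e u1 u2 u3, e \in E -> uniq [:: u1; u2; u3] ->
        (forall u, u \in [:: u1; u2; u3] -> u \in e) ->
        ~ (forall u, u \in [:: u1; u2; u3] ->
             u = v \/ exists2 f, f \in E :\ e & u \in f)].

Lemma chunk0E e v u s : #|e| = k.+1 -> v \in e -> u \in e -> v != u ->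
  chunk (v :: enum (e :\ v :\ u) ++ u :: s) 0 = e.
Proof.
move=> cE ve ue neq_vu.
have sz : size (enum (e :\ v :\ u)) = k.-1.
  have := cardsD1 u (e :\ v); have := cardsD1 v e.
  by rewrite ve cE -cardE !inE eq_sym neq_vu ue /=; lia.
have k_gt0 : 0 < k.
  by have : 1 < #|e|; [apply/card_gt1P; exists v, u | rewrite cE].
apply/setP => x; rewrite inE drop0 /= take_cat sz ltnNge leq_pred /=.
rewrite (_ : k - k.-1 = 1); last by lia.
rewrite /= take0 inE mem_cat mem_enum mem_seq1 !inE.
have [->|neq_xv] := eqVneq x v; first by rewrite ve.
have [->|neq_xu] := eqVneq x u; first by rewrite ue orbT.
by rewrite orbF.
Qed.

(** The edge [e] at [v] is removed, and at most one other vertex [u] of [e] carries a branch. The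
    list consists of [v], the rest of [e], [u] and the list of that branch. The last conclusion
    keeps the list free of repetitions: a later entry lies in the branch at [u], so it is no other
    vertex of [e]. *)
Lemma unbranched_chain n E v : n = #|E| -> 0 < k -> acyclic E -> uniform k.+1 E ->
    component E v = E -> unbranched_from E v ->
  exists s, [/\ uniq (v :: s), size s = n * k,
    E = [set chunk (v :: s) i | i : 'I_n]
    & forall x, x \in s -> exists2 f, f \in E & x \in f].
Proof.
elim: n E v => [|n IHn] E v /esym cardE k_gt0 acE Er cE [deg single nb].
  exists [::]; split=> //; move/eqP: cardE; rewrite cards_eq0 => /eqP ->.
  by apply/esym/eqP; rewrite -subset0; apply/subsetP => f /imsetP[[]].
have [e eE ve] : exists2 e, e \in E & v \in e.
  by apply: component_neq0; rewrite cE -card_gt0 cardE.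
pose C u := component (E :\ e) u.
have Cv0 : C v = set0.
  apply/eqP; apply: contraT => /component_neq0[f /setD1P[/eqP neq_fe fE] vf].
  by case: neq_fe; apply: single.
have [u [ue neq_vu Cu0]] : exists u, [/\ u \in e, v != u
    & forall u', u' \in e -> u' != u -> C u' = set0].
  have [/existsP[u /andP[ue Cu]]|noC] := boolP [exists u in e, C u != set0].
    have neq_vu : v != u by apply: contraNneq Cu => <-; rewrite Cv0.
    exists u; split=> // u' u'e neq_u'u; apply/eqP; apply: contraT => Cu'.
    have neq_vu' : v != u' by apply: contraNneq Cu' => <-; rewrite Cv0.
    case: (nb e v u u' eE) => [||w].
    - by rewrite /= !inE negb_or neq_vu neq_vu' eq_sym neq_u'u.
    - by move=> w; rewrite !inE => /or3P[] /eqP ->.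
    rewrite !inE => /or3P[] /eqP ->; first by left.
      by right; exact: component_neq0.
    by right; exact: component_neq0.
  (* Without any branch [e] is the last edge, and any vertex other than [v] may end the chain. *)
  have /card_gt0P[u] : 0 < #|e :\ v| by have := cardsD1 v e; rewrite ve Er //; lia.
  case/setD1P=> neq_uv ue; exists u; rewrite eq_sym; split=> // u' u'e _.
  by apply/eqP; apply: contraNT noC => Cu'; apply/existsP; exists u'; rewrite u'e.
have cardC : #|C u| = n.
  have := card_component acE eE ve cE; rewrite cardE (bigD1 u) //= big1 => [|w].
    by rewrite addn0 => -[].
  by case/andP=> we /(Cu0 w we) Cw; rewrite -/(C w) Cw cards0.
have sCE : C u \subset E := subset_trans (component_subset _ _) (subsetDl _ _).
have eNC : e \notin C u by apply/negP => /componentP[]; rewrite !inE eqxx.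
have E_split : E = e |: C u.
  apply/eqP; rewrite eq_sym eqEcard; apply/andP; split.
    by rewrite subUset sub1set eE.
  by rewrite cardsU1 eNC cardC cardE.
have [||||s [Us sz_s C_chunk s_cov]] := IHn (C u) u (esym cardC) k_gt0.
- exact: acyclic_subset sCE acE.
- by move=> f /(subsetP sCE); exact: Er.
- exact: component_component.
- split.
  + move=> w [e1 [e2 [e3 [Ue he]]]]; case: (deg w); exists e1, e2, e3; split=> // f.
    by move/he => /andP[/(subsetP sCE) -> ->].
  + move=> f f' fC f'C uf uf'; apply/eqP; apply: contraT => neq_ff'.
    case: (deg u); exists e, f, f'; split.
      rewrite /= !inE negb_or neq_ff' !andbT.
      by apply/andP; split; apply: contraNneq eNC => ->.
    by move=> f0; rewrite !inE => /or3P[] /eqP ->;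
      rewrite ?eE ?ue // ?uf ?uf' andbT (subsetP sCE).
  move=> f u1 u2 u3 fC Uu uf hu; case: (nb f u1 u2 u3 (subsetP sCE _ fC) Uu uf).
  move=> w /hu [->|[f' /setD1P[neq_f f'C] wf']]; right.
    by exists e; rewrite // !inE eE andbT; apply: contraNneq eNC => ->.
  by exists f'; rewrite // !inE neq_f (subsetP sCE).
have sz_e : size (enum (e :\ v :\ u)) = k.-1.
  have := cardsD1 u (e :\ v); have := cardsD1 v e.
  by rewrite ve (Er _ eE) -fintype.cardE !inE eq_sym neq_vu ue /=; lia.
exists (enum (e :\ v :\ u) ++ u :: s); split.
- have disj x : x \in e -> x != u -> x \notin s.
    move=> xe neq_xu; apply/negP => /s_cov[f fC xf].
    have /componentP[fF _] := fC.
    have := component_inj acE eE ue xe fC (mem_component fF xf).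
    by move=> eq_ux; rewrite eq_ux eqxx in neq_xu.
  rewrite cons_uniq mem_cat mem_enum !inE eqxx /= andbF /= negb_or neq_vu disj //=.
  rewrite cat_uniq enum_uniq Us andbT andTb; apply/hasPn => x; rewrite inE mem_enum !inE.
  case/predU1P=> [->|xs]; first by rewrite eqxx.
  by apply/negP => /and3P[neq_xu _ xe]; rewrite (negPf (disj x xe neq_xu)) in xs.
- by rewrite size_cat /= sz_e sz_s mulSn; lia.
- have chunkS i : chunk (v :: enum (e :\ v :\ u) ++ u :: s) i.+1 = chunk (u :: s) i.
    rewrite /chunk mulSn -cat_cons addnC -drop_drop drop_size_cat //=.
    by rewrite sz_e prednK.
  rewrite {1}E_split; apply/setP => f; apply/setU1P/imsetP.
    case=> [->|]; first by exists ord0; rewrite // chunk0E // Er.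
    by rewrite C_chunk => /imsetP[i _ ->]; exists (lift ord0 i); rewrite // lift0 chunkS.
  case=> i _ ->; case: (unliftP ord0 i) => [j|] ->; last by left; rewrite chunk0E // Er.
  by right; rewrite lift0 chunkS C_chunk imset_f.
move=> x; rewrite mem_cat mem_enum !inE => /orP[/and3P[_ _ xe]|]; first by exists e.
case/predU1P=> [->|/s_cov[f fC xf]]; first by exists e.
by exists f; rewrite // (subsetP sCE).
Qed.

(** Let the branch of [e] at [u] be as large as possible. If another vertex [u'] of [e] were on an
    edge [f] other than [e], the branch of [f] at [u'] would contain [e] and the whole branch at
    [u]. So the vertices of [e] other than [u] are core, and any of them is a root. *)
Lemma unbranched_root E : E != set0 -> 1 < k -> acyclic E -> uniform k.+1 E ->
    (forall w, ~ branching_vertex E w) -> (forall e, ~ branching_edge E e) ->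
  exists v, unbranched_from E v.
Proof.
move=> E0 k_gt1 acE Er degv dege.
have [e [u [eE ue Cmax]]] : exists e u, [/\ e \in E, u \in e
    & forall f w, f \in E -> w \in f ->
        #|component (E :\ f) w| <= #|component (E :\ e) u|].
  have /set0Pn[e0 e0E] := E0; have /card_gt0P[u0 u0e] : 0 < #|e0| by rewrite Er.
  pose P (p : {set V} * V) := (p.1 \in E) && (p.2 \in p.1).
  have P0 : P (e0, u0) by rewrite /P e0E.
  case: (@arg_maxnP _ _ P (fun p => #|component (E :\ p.1) p.2|) P0).
  move=> [e u] /andP[/= eE ue] Cmax; exists e, u; split=> // f w fE wf.
  by apply: (Cmax (f, w)); rewrite /P /= fE.
have core u' f : u' \in e -> u' != u -> f \in E -> u' \in f -> f = e.
  move=> u'e neq_u'u fE u'f; apply/eqP; apply: contraT => neq_fe.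
  have fNC : f \notin component (E :\ e) u.
    apply: contra neq_u'u => fC; rewrite eq_sym; apply/eqP.
    apply: (component_inj acE eE ue u'e fC); apply: mem_component => //.
    by rewrite !inE neq_fe.
  have sub : component (E :\ e) u \subset E :\ f.
    apply/subsetP => g gC; rewrite !inE; apply/andP; split.
      by apply: contraNneq fNC => <-.
    by case/componentP: gC => /setD1P[].
  have := Cmax f u' fE u'f; rewrite leqNgt => /negP[].
  apply: proper_card; apply/properP; split; last first.
    exists e; first by apply: mem_component; rewrite // !inE eq_sym neq_fe.
    by apply/negP => /componentP[]; rewrite !inE eqxx.
  apply/subsetP => g gC; apply/componentP; split; first exact: (subsetP sub).
  have := gC; rewrite -component_component => /componentP[_ [w wg uw]]; exists w => //.
  apply: (connect_trans (y := u)).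
    by apply/connect1/adjacentP; exists e; rewrite !inE eq_sym neq_fe.
  by apply: connect_sub uw => x y; exact: adjacent_subset.
have /card_gt0P[v /setD1P[neq_vu ve]] : 0 < #|e :\ u|.
  by have := cardsD1 u e; rewrite ue Er //; lia.
exists v; split=> // [e1 e2 e1E e2E ve1 ve2|f u1 u2 u3 fE Uu uf hu].
  by rewrite (core v e1) // (core v e2).
have [vu|/negP Nvu] := boolP (v \in [:: u1; u2; u3]); last first.
  case: (dege f); split=> //; exists u1, u2, u3; split=> // w wu.
  by case: (hu w wu) => // eq_wv; case: Nvu; rewrite -eq_wv.
have eq_fe : f = e by apply: (core v) => //; exact: uf.
have toU w : w \in [:: u1; u2; u3] -> (w == v) || (w == u).
  move=> wu; case: (hu w wu) => [->|[g /setD1P[neq_gf gE] wg]]; first by rewrite eqxx.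
  apply/orP; right; apply: contraNT neq_gf => neq_wu; apply/eqP.
  by rewrite eq_fe; apply: (core w) => //; rewrite -eq_fe; exact: uf.
have : size [:: u1; u2; u3] <= size [:: v; u].
  by apply: uniq_leq_size => // w /toU; rewrite !inE.
by [].
Qed.

End Chains.

(** The isomorphism sends a vertex to its position in the list given by [unbranched_chain]. *)
Lemma unbranched_isomorphic (r m : nat) (V : finType) (E : {set {set V}}) :
    (2 < r)%N -> (0 < m)%N -> supertree r E -> #|E| = m ->
    (forall w, ~ branching_vertex E w) -> (forall e, ~ branching_edge E e) ->
  isomorphic E (loose_path r m).
Proof.
case: r => // k k_gt1 m_gt0 [Er _ cE acE] cardE degv dege.
have E0 : E != set0 by rewrite -card_gt0 cardE.
have cc v : component E v = E.
  by apply: component_connected => // e eE; rewrite -card_gt0 Er.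
have [v unb] := unbranched_root E0 k_gt1 acE Er degv dege.
have [s [Us sz_s E_chunk _]] :=
  unbranched_chain (esym cardE) (ltnW k_gt1) acE Er (cc v) unb.
have in_s x : x \in v :: s.
  have [e + xe] : exists2 e, e \in E & x \in e by apply: component_neq0; rewrite cc.
  rewrite E_chunk => /imsetP[i _ eq_e]; move: xe; rewrite eq_e inE.
  by move/mem_take/mem_drop.
have sz_vs : size (v :: s) = (m * k).+1 by rewrite /= sz_s.
have lt_index x : (index x (v :: s) < (m * k).+1)%N.
  by rewrite -sz_vs index_mem.
pose f x : 'I_(m * k).+1 := Ordinal (lt_index x).
pose h (j : 'I_(m * k).+1) := nth v (v :: s) j.
have fK : cancel f h by move=> x; exact: nth_index.
have lt_size (j : 'I_(m * k).+1) : (j < size (v :: s))%N by rewrite sz_vs ltn_ord.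
have hK : cancel h f by move=> j; apply: val_inj; exact: index_uniq (lt_size j) Us.
exists f; first by exists h.
have f_chunk i : (i < m)%N -> f @: chunk k (v :: s) i = path_edge k.+1 m i.
  move=> lt_im; rewrite (can2_imset_pre _ fK hK); apply/setP => j.
  have le_im : (k + i * k <= m * k)%N by rewrite -mulSn leq_mul2r lt_im orbT.
  have sz_take : size (take k.+1 (drop (i * k) (v :: s))) = k.+1.
    by rewrite size_takel // size_drop sz_vs; lia.
  rewrite !inE /h [_.+1.-1]/= mulSn; apply/(nthP v)/andP => [[t]|[le_j j_le]].
    rewrite sz_take => lt_t; rewrite nth_take // nth_drop => /eqP.
    rewrite nth_uniq ?lt_size //; last by rewrite sz_vs; lia.
    by move=> /eqP <-; lia.
  exists (j - i * k)%N; first by rewrite sz_take; lia.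
  by rewrite nth_take ?nth_drop ?subnKC //; lia.
rewrite loose_pathE E_chunk; apply/setP => e; apply/imsetP/imsetP.
  by case=> i _ ->; exists (chunk k (v :: s) i); rewrite ?imset_f // f_chunk.
by case=> _ /imsetP[i _ ->] ->; exists i; rewrite // f_chunk.
Qed.

Theorem theorem6p2 (R : realType) (r m : nat) (hr : (3 <= r)%N)
    (hm : (4 <= m)%N) :
  [/\ supertree r (loose_path r m) /\ #|loose_path r m| = m,
      supertree r (D_supertree r m) /\ #|D_supertree r m| = m,
      spectral_radius R r (loose_path r m)
        < spectral_radius R r (D_supertree r m)
    & forall (V : finType) (T : {set {set V}}),
        supertree r T -> #|T| = m -> ~ isomorphic T (loose_path r m) ->
        spectral_radius R r (D_supertree r m) <= spectral_radius R r T].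
Proof.
have m_gt0 : (0 < m)%N by lia.
have r_gt0 : (0 < r)%N by lia.
have [D_tree cardD] := @D_supertree_supertree r m hr (ltnW (ltnW hm)).
have D_le (V : finType) (T : {set {set V}}) : supertree r T -> #|T| = m ->
    (exists v, branching_vertex T v) \/ (exists e, branching_edge T e) ->
  spectral_radius R r (D_supertree r m) <= spectral_radius R r T.
  move=> T_tree cardT brT.
  have [|rho_gt0 al_gt0] := branched_gap R r_gt0 T_tree _ brT; first by rewrite cardT.
  rewrite cardT => al_le; case: m hm al_le {m_gt0 D_tree cardD cardT} => // n n_gt2.
  by rewrite !subSS subn2; exact: spectral_radius_D_le.
have brD : exists e, branching_edge (D_supertree r m) e.
  case: m hm {m_gt0 D_tree cardD D_le} => // n n_gt2.
  by eexists; exact: D_branched.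
split=> //; first exact: loose_path_supertree.
  have [|rho_gt0 al_gt0] := branched_gap R r_gt0 D_tree _ (or_intror brD).
    by rewrite cardD.
  have m3_gt0 : (0 < m - 3)%N by rewrite subn_gt0.
  have eq_m : (m - 3).+2 = m.-1 by lia.
  rewrite cardD => /(gap_of_gap3 al_gt0 m3_gt0); rewrite eq_m => al_lt.
  by apply: spectral_radius_path_lt => //; lia.
move=> V T T_tree cardT not_path; apply: D_le => //.
apply: contrapT => /not_orP[Nv Ne]; apply: not_path.
apply: unbranched_isomorphic => // [w brw|e bre]; [apply: Nv|apply: Ne].
  by exists w.
by exists e.
Qed.
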